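(* Let $\varphi_0:L^\infty\to\mathbb{R}$ be a finite-valued monotone convex function with the Lebesgue property on $L^\infty$ and $\varphi_0(0)=0$, and let $\mathbb{Q}$, $M^{\hat\varphi}_u(\mathbb{Q})$ and $\|\cdot\|_{\hat\varphi,\mathbb{Q}}$ be as defined in the context. Then $(M^{\hat\varphi}_u(\mathbb{Q}),\|\cdot\|_{\hat\varphi,\mathbb{Q}})$ is an order-continuous Banach lattice, i.e. $M^{\hat\varphi}_u(\mathbb{Q})$ is complete for $\|\cdot\|_{\hat\varphi,\mathbb{Q}}$ and the norm is order-continuous with respect to the $\mathbb{Q}$-a.s. order: whenever $|\xi_n|\le\eta\in M^{\hat\varphi}_u(\mathbb{Q})$ for all $n$ and $\xi_n\to0$ $\mathbb{Q}$-a.s., one has $\|\xi_n\|_{\hat\varphi,\mathbb{Q}}\to0$.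
   Context: $(\Omega,\mathcal{F},\mathbb{P})$ is a probability space; $L^0=L^0(\mathbb{P})$ is the space of finite real random variables modulo $\mathbb{P}$-a.s. equality with the a.s. pointwise order; $L^p=L^p(\Omega,\mathcal F,\mathbb P)$; $\mathbb{E}$ is expectation under $\mathbb{P}$; $X^-=\max(-X,0)$. A monotone convex function on $L^\infty$ is a proper convex function $\varphi:L^\infty\to(-\infty,\infty]$ with $X\le Y$ a.s. $\Rightarrow\varphi(X)\le\varphi(Y)$. It has the Lebesgue property on $L^\infty$ if $\sup_n\|X_n\|_\infty<\infty$ and $X_n\to X$ a.s. imply $\varphi(X)=\lim_n\varphi(X_n)$. Definitions associated to $\varphi_0$: $\varphi_0^*(Z)=\sup_{X\in L^\infty}(\mathbb{E}[XZ]-\varphi_0(X))$ for $Z\in L^1$, $\mathrm{dom}\,\varphi_0^*=\{Z\in L^1:\varphi_0^*(Z)<\infty\}$ (every element of which is $\ge0$); $\mathcal{D}_0=\{X\in L^0: X^-Z\in L^1\ \forall Z\in\mathrm{dom}\,\varphi_0^*\}$; $\hat\varphi(X)=\sup_{Z\in\mathrm{dom}\,\varphi_0^*}(\mathbb{E}[XZ]-\varphi_0^*(Z))$ for $X\in\mathcal{D}_0$ (note $L^0_+\subset\mathcal{D}_0$); $$M^{\hat\varphi}_u=\Big\{X\in L^0:\ \lim_{N\to\infty}\hat\varphi\big(\alpha|X|\mathbf{1}_{\{|X|>N\}}\big)=0\ \ \forall\alpha>0\Big\};$$ $\|X\|_{\hat\varphi}=\inf\{\lambda>0:\hat\varphi(|X|/\lambda)\le1\}$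 for $X\in L^0$ ($\inf\emptyset=+\infty$). The measure $\mathbb{Q}$: there exists $\hat Z\in\mathrm{dom}\,\varphi_0^*$ with $\varphi_0^*(\hat Z)\le1$ such that for every $A\in\mathcal{F}$, $\mathbb{E}[\hat Z\mathbf{1}_A]=0$ implies $\mathbb{E}[Z\mathbf{1}_A]=0$ for all $Z\in\mathrm{dom}\,\varphi_0^*$. Fix such a $\hat Z$, with $\mathbb{E}[\hat Z]>0$, and let $\mathbb{Q}$ be the probability measure $d\mathbb{Q}/d\mathbb{P}=\hat Z/\mathbb{E}[\hat Z]$. Let $L^0(\mathbb{Q})$ be the space of finite real random variables modulo $\mathbb{Q}$-a.s. equality with the $\mathbb{Q}$-a.s. order, and let $\pi:L^0(\mathbb{P})\to L^0(\mathbb{Q})$ be the canonical map sending the $\mathbb{P}$-class of a random variable to its $\mathbb{Q}$-class. Put $M^{\hat\varphi}_u(\mathbb{Q})=\pi(M^{\hat\varphi}_u)$ and $\|\xi\|_{\hat\varphi,\mathbb{Q}}=\|X\|_{\hat\varphi}$ whenever $\xi=\pi(X)$ (this does not depend on the choice of $X$). *)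

(* Defs.v *)
From HB Require Import structures.
From mathcomp Require Import all_boot all_order all_algebra.
From mathcomp Require Import all_classical all_reals all_analysis.
From mathcomp Require Import measurable_realfun ess_sup_inf.

Set Implicit Arguments.
Unset Strict Implicit.
Unset Printing Implicit Defensive.
Import Order.TTheory GRing.Theory Num.Theory numFieldNormedType.Exports.

Local Open Scope classical_set_scope.
Local Open Scope ring_scope.

Section L0.
Context d (T : measurableType d) (R : realType).
Variable mu : {measure set T -> \bar R}.

Definition L0 : Type := {mfun_ mu, T >-> R}.
HB.instance Definition _ := Choice.on L0.
HB.instance Definition _ := EqQuotient.on L0.

Definition L0cls (f : {mfun T >-> R}) : L0 := (\pi_L0 f)%qT.
(* Applying a class to a point uses the representative chosen by [repr]; the
   notions below are all invariant under a.e. equality. *)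
Definition L0rep (X : L0) : {mfun T >-> R} := repr X.
Coercion L0rep : L0 >-> MeasurableFun.type.

Implicit Types (X Y Z : L0) (f g : {mfun T >-> R}) (a : R).

Lemma L0_eqP X Y : X = Y <-> \forall w \ae mu, X w = Y w.
Proof.
split=> [->|XY]; first by apply: nearW.
rewrite -[X]reprK -[Y]reprK; apply/eqmodP/asboolP.
by move: XY; apply: filterS => w + _.
Qed.

Lemma L0clsE f : \forall w \ae mu, L0cls f w = f w.
Proof.
have /eqmodP/asboolP : (\pi_L0 (repr (L0cls f)) = \pi_L0 f)%qT by rewrite reprK.
by apply: filterS => w /(_ I).
Qed.

Lemma L0repK X : L0cls (L0rep X) = X.
Proof. exact: reprK. Qed.

Lemma L0cls_eq f g : (\forall w \ae mu, f w = g w) -> L0cls f = L0cls g.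
Proof.
move=> fg; apply/L0_eqP; near=> w.
by rewrite (near (L0clsE f) w)// (near (L0clsE g) w)// (near fg w).
Unshelve. all: by end_near. Qed.

Definition L0add X Y := L0cls (L0rep X + L0rep Y).
Definition L0opp X := L0cls (- L0rep X).
Definition L0scale a X := L0cls (a *: L0rep X).
Definition L0join X Y := L0cls (max_mfun (L0rep X) (L0rep Y)).
Definition L0meet X Y := L0cls (min_mfun (L0rep X) (L0rep Y)).
Definition L0le X Y := `[< \forall w \ae mu, X w <= Y w >].

Let addE X Y : \forall w \ae mu, L0add X Y w = X w + Y w.
Proof. exact: L0clsE. Qed.
Let oppE X : \forall w \ae mu, L0opp X w = - X w.
Proof. exact: L0clsE. Qed.
Let scaleE a X : \forall w \ae mu, L0scale a X w = a * X w.
Proof. exact: L0clsE. Qed.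
Let joinE X Y : \forall w \ae mu, L0join X Y w = Num.max (X w) (Y w).
Proof. exact: L0clsE. Qed.
Let meetE X Y : \forall w \ae mu, L0meet X Y w = Num.min (X w) (Y w).
Proof. exact: L0clsE. Qed.
Let cls0E : \forall w \ae mu, L0cls 0 w = 0.
Proof. exact: L0clsE. Qed.

Let addA : associative L0add.
Proof.
move=> X Y Z; apply/L0_eqP; near=> w.
rewrite (near (addE _ _) w)// (near (addE Y Z) w)// (near (addE (L0add _ _) _) w)//.
by rewrite (near (addE X Y) w)// addrA.
Unshelve. all: by end_near. Qed.

Let addC : commutative L0add.
Proof. by move=> X Y; rewrite /L0add addrC. Qed.

Let add0 : left_id (L0cls 0) L0add.
Proof.
move=> X; apply/L0_eqP; near=> w.
by rewrite (near (addE _ _) w)// (near cls0E w)// add0r.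
Unshelve. all: by end_near. Qed.

Let addN : left_inverse (L0cls 0) L0opp L0add.
Proof.
move=> X; apply/L0_eqP; near=> w.
by rewrite (near (addE _ _) w)// (near cls0E w)// (near (oppE _) w)// addNr.
Unshelve. all: by end_near. Qed.

HB.instance Definition _ := GRing.isZmodule.Build L0 addA addC add0 addN.

Let scaleA a b X : L0scale a (L0scale b X) = L0scale (a * b) X.
Proof.
apply/L0_eqP; near=> w.
rewrite (near (scaleE a _) w)// (near (scaleE b _) w)//.
by rewrite (near (scaleE _ X) w)// mulrA.
Unshelve. all: by end_near. Qed.

Let scale1 : left_id 1 L0scale.
Proof. by move=> X; rewrite /L0scale scale1r L0repK. Qed.

Let scaleDr : right_distributive L0scale +%R.
Proof.
move=> a X Y; apply/L0_eqP; near=> w.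
rewrite (near (scaleE a _) w)// (near (addE X Y) w)// (near (addE _ _) w)//.
by rewrite (near (scaleE a X) w)// (near (scaleE a Y) w)// mulrDr.
Unshelve. all: by end_near. Qed.

Let scaleDl X : {morph L0scale^~ X : a b / a + b}.
Proof.
move=> a b; apply/L0_eqP; near=> w.
rewrite (near (scaleE _ X) w)// (near (addE _ _) w)//.
by rewrite (near (scaleE a X) w)// (near (scaleE b X) w)// mulrDl.
Unshelve. all: by end_near. Qed.

HB.instance Definition _ :=
  GRing.Zmodule_isLmodule.Build R L0 scaleA scale1 scaleDr scaleDl.

Let le_refl : reflexive L0le.
Proof. by move=> X; apply/asboolP/nearW. Qed.

Let le_anti : antisymmetric L0le.
Proof.
move=> X Y /andP[/asboolP XY /asboolP YX]; apply/L0_eqP; near=> w.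
by apply/le_anti; rewrite (near XY w)// (near YX w).
Unshelve. all: by end_near. Qed.

Let le_trans : transitive L0le.
Proof.
move=> Y X Z /asboolP XY /asboolP YZ; apply/asboolP; near=> w.
by rewrite (le_trans (near XY w _))// (near YZ w).
Unshelve. all: by end_near. Qed.

HB.instance Definition _ :=
  Order.Le_isPOrder.Build ring_display L0 le_refl le_anti le_trans.

Let meetC : commutative L0meet.
Proof.
move=> X Y; apply/L0_eqP; near=> w.
by rewrite (near (meetE X Y) w)// (near (meetE Y X) w)// minC.
Unshelve. all: by end_near. Qed.

Let joinC : commutative L0join.
Proof.
move=> X Y; apply/L0_eqP; near=> w.
by rewrite (near (joinE X Y) w)// (near (joinE Y X) w)// maxC.
Unshelve. all: by end_near. Qed.

Let meetA : associative L0meet.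
Proof.
move=> X Y Z; apply/L0_eqP; near=> w.
rewrite (near (meetE X _) w)// (near (meetE Y Z) w)// (near (meetE _ Z) w)//.
by rewrite (near (meetE X Y) w)// minA.
Unshelve. all: by end_near. Qed.

Let joinA : associative L0join.
Proof.
move=> X Y Z; apply/L0_eqP; near=> w.
rewrite (near (joinE X _) w)// (near (joinE Y Z) w)// (near (joinE _ Z) w)//.
by rewrite (near (joinE X Y) w)// maxA.
Unshelve. all: by end_near. Qed.

Let joinKI Y X : L0meet X (L0join X Y) = X.
Proof.
apply/L0_eqP; near=> w.
rewrite (near (meetE X _) w)// (near (joinE X Y) w)//.
by rewrite -{1}joinEtotal -meetEtotal joinKI.
Unshelve. all: by end_near. Qed.

Let meetKU Y X : L0join X (L0meet X Y) = X.
Proof.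
apply/L0_eqP; near=> w.
rewrite (near (joinE X _) w)// (near (meetE X Y) w)//.
by rewrite -meetEtotal -joinEtotal meetKU.
Unshelve. all: by end_near. Qed.

Let leEmeet X Y : (X <= Y) = (L0meet X Y == X).
Proof.
apply/asboolP/eqP => [XY|/L0_eqP XY].
  apply/L0_eqP; near=> w.
  by rewrite (near (meetE X Y) w)//; apply/min_idPl; rewrite (near XY w).
near=> w; apply/min_idPl.
by rewrite -(near (meetE X Y) w)// (near XY w).
Unshelve. all: by end_near. Qed.

HB.instance Definition _ := Order.POrder_isLattice.Build ring_display L0
  meetC joinC meetA joinA joinKI meetKU leEmeet.

Lemma L0D X Y : \forall w \ae mu, (X + Y : L0) w = X w + Y w.
Proof. exact: addE. Qed.
Lemma L0N X : \forall w \ae mu, (- X : L0) w = - X w.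
Proof. exact: oppE. Qed.
Lemma L0Z a X : \forall w \ae mu, (a *: X : L0) w = a * X w.
Proof. exact: scaleE. Qed.
Lemma L0_0 : \forall w \ae mu, (0 : L0) w = 0.
Proof. exact: cls0E. Qed.
Lemma L0U X Y : \forall w \ae mu, (Order.join X Y : L0) w = Num.max (X w) (Y w).
Proof. exact: joinE. Qed.
Lemma L0I X Y : \forall w \ae mu, (Order.meet X Y : L0) w = Num.min (X w) (Y w).
Proof. exact: meetE. Qed.
Lemma L0_leP X Y : X <= Y <-> \forall w \ae mu, X w <= Y w.
Proof. by split=> /asboolP. Qed.

Definition L0abs X : L0 := Order.join X (- X).

Lemma L0absE X : \forall w \ae mu, L0abs X w = `|X w|.
Proof.
near=> w.
by rewrite (near (L0U X _) w)// (near (L0N X) w)// maxrN.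
Unshelve. all: by end_near. Qed.

End L0.

Section Lp.
Context d (T : measurableType d) (R : realType).
Variable mu : {measure set T -> \bar R}.

Lemma ae_eq_Lnorm (p : \bar R) (f g : {mfun T >-> R}) :
  (\forall w \ae mu, f w = g w) ->
  ('N[mu]_p[EFin \o f] = 'N[mu]_p[EFin \o g])%E.
Proof.
move=> fg; rewrite unlock; case: p => [r||].
- congr (_ `^ _)%E; apply: ae_eq_integral => //.
  + apply: (measurableT_comp (measurable_poweR _)).
    by apply: measurableT_comp => //; apply/measurable_EFinP.
  + apply: (measurableT_comp (measurable_poweR _)).
    by apply: measurableT_comp => //; apply/measurable_EFinP.
  + by apply: filterS fg => w /= -> _.
- by rewrite (@eq_ess_sup _ _ _ _ _ (abse \o (EFin \o g)))//; apply: filterS fg => w /= ->.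
- by rewrite (@eq_ess_inf _ _ _ _ _ (abse \o (EFin \o g)))//; apply: filterS fg => w /= ->.
Qed.

Lemma L0cls_Lfun (p : \bar R) (f : {mfun T >-> R}) :
  ((L0cls mu f : T -> R) \in Lfun mu p) = ((f : T -> R) \in Lfun mu p).
Proof.
have LE (g : {mfun T >-> R}) :
    ((g : T -> R) \in Lfun mu p) = ('N[mu]_p[EFin \o g] < +oo)%E.
  apply/idP/idP => [/andP[_]|gp]; first by rewrite inE.
  by apply/andP; split; apply/mem_set; [exact: measurable_funP|].
by rewrite !LE (ae_eq_Lnorm p (L0clsE mu f)).
Qed.

Variables (p : \bar R) (p1 : (1 <= p)%E).

Definition LpL0 of (1 <= p)%E : {pred L0 mu} :=
  fun X => (X : T -> R) \in Lfun mu p.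

Lemma LpL0_submod_closed : submod_closed (LpL0 p1).
Proof.
have [Lf0 LfD] := Lfun_submod_closed mu p1.
split=> [|a X Y XL YL]; rewrite -topredE/= /LpL0.
  by rewrite [0]/(L0cls mu 0) L0cls_Lfun.
suff -> : a *: X + Y = L0cls mu (a *: L0rep X + L0rep Y).
  by rewrite L0cls_Lfun; exact: LfD.
apply/L0_eqP; near=> w.
rewrite (near (L0D _ _) w)// (near (L0Z _ _) w)//.
by rewrite (near (L0clsE mu (a *: L0rep X + L0rep Y)) w).
Unshelve. all: by end_near. Qed.

HB.instance Definition _ :=
  GRing.isSubmodClosed.Build R (L0 mu) (LpL0 p1) LpL0_submod_closed.

Definition Lp : Type := {X : L0 mu | X \in LpL0 p1}.
HB.instance Definition _ := SubChoice.on Lp.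
HB.instance Definition _ := [SubChoice_isSubLmodule of Lp by <:].
Definition Lp_val (X : Lp) : L0 mu := val X.
Coercion Lp_val : Lp >-> L0.

End Lp.

Section banach_lattice.
Context d (T : measurableType d) (R : realType).
Variable mu : {measure set T -> \bar R}.
Variables (M : set (L0 mu)) (N : L0 mu -> \bar R).
Implicit Types (X Y : L0 mu) (U : nat -> L0 mu).
Local Open Scope ereal_scope.

Definition vector_sublattice : Prop :=
  [/\ M 0%R,
      forall (a : R) X Y, M X -> M Y -> M (a *: X + Y)%R,
      forall X Y, M X -> M Y -> M (Order.join X Y) &
      forall X Y, M X -> M Y -> M (Order.meet X Y)].

(* [N] may take the value +oo off [M]. *)
Definition norm_on : Prop :=
  [/\ forall X, M X -> 0 <= N X < +oo,
      forall X, M X -> N X = 0 -> X = 0%R,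
      forall (a : R) X, M X -> N (a *: X)%R = `|a|%:E * N X &
      forall X Y, M X -> M Y -> N (X + Y)%R <= N X + N Y].

Definition monotone_norm_on : Prop :=
  forall X Y, M X -> M Y -> (L0abs X <= L0abs Y)%R -> N X <= N Y.

Definition complete_for_norm : Prop :=
  forall U, (forall n, M (U n)) ->
    (forall e : R, (0 < e)%R ->
       exists n0, forall m n, (n0 <= m)%N -> (n0 <= n)%N ->
         N (U m - U n)%R < e%:E) ->
    exists2 X, M X & N (U n - X)%R @[n --> \oo] --> 0.

Definition banach_lattice : Prop :=
  [/\ vector_sublattice, norm_on, monotone_norm_on & complete_for_norm].

Definition order_continuous_norm : Prop :=
  forall U Y, M Y -> (forall n, L0abs (U n) <= Y)%R ->
    (\forall w \ae mu, U n w @[n --> \oo] --> (0 : R)%R) ->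
    N (U n) @[n --> \oo] --> 0.

End banach_lattice.

Notation Linfty P := (Lp P (leey 1%E)).
Notation L1 P := (Lp P (lexx 1%E)).

Section monotone_convex.
Context d (T : measurableType d) (R : realType) (P : probability T R).
Variable phi0 : Linfty P -> R.
Local Open Scope ereal_scope.

Definition monotone_convex : Prop :=
  convex_function [set: convex_lmodType (Linfty P)] phi0 /\
  forall X Y : Linfty P, ((X : L0 P) <= (Y : L0 P))%R -> (phi0 X <= phi0 Y)%R.

Definition lebesgue_property : Prop :=
  forall (U : nat -> Linfty P) (X : Linfty P),
    ereal_sup [set 'N[P]_+oo[EFin \o U n] | n in [set: nat]] < +oo ->
    (\forall w \ae P, U n w @[n --> \oo] --> X w) ->
    phi0 (U n) @[n --> \oo] --> phi0 X.

Definition conjugate (Z : L1 P) : \bar R :=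
  ereal_sup [set 'E_P[(X : T -> R) \* Z] - (phi0 X)%:E | X in [set: Linfty P]].

Definition dom_conjugate : set (L1 P) := [set Z | conjugate Z < +oo].

Definition D0 : set (L0 P) :=
  [set X | forall Z, dom_conjugate Z ->
     ((X : T -> R)^\- \* Z)%R \in Lfun P 1].

(* Meaningful on [D0], which contains all [X >= 0] (see [ge0_D0]); off [D0] the
   expectations may be undefined in the usual sense. *)
Definition phihat (X : L0 P) : \bar R :=
  ereal_sup [set 'E_P[(X : T -> R) \* Z] - conjugate Z | Z in dom_conjugate].

Definition truncate_below (r x : R) : R := (if r < `|x| then `|x| else 0)%R.

Lemma measurable_truncate_below r : measurable_fun [set: R] (truncate_below r).
Proof.
apply: measurable_fun_ifT => //.
by apply: measurable_fun_ltr => //; exact: normr_measurable.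
Qed.

HB.instance Definition _ r := isMeasurableFun.Build _ _ _ _
  (truncate_below r) (measurable_truncate_below r).

(* The class of |X| 1_{|X| > r}. *)
Definition tail (r : R) (X : L0 P) : L0 P :=
  L0cls P (truncate_below r \o L0rep X).

Definition Mu : set (L0 P) :=
  [set X | forall a : R, (0 < a)%R ->
     phihat (a *: tail n%:R X)%R @[n --> \oo] --> 0].

Definition luxemburg (X : L0 P) : \bar R :=
  ereal_inf [set l%:E | l in
    [set l : R | (0 < l)%R /\ phihat (l^-1 *: L0abs X)%R <= 1]].

Definition dominating (Zhat : L1 P) : Prop :=
  [/\ dom_conjugate Zhat, conjugate Zhat <= 1 &
      forall A, measurable A -> 'E_P[(Zhat : T -> R) \* \1_A] = 0 ->
        forall Z, dom_conjugate Z -> 'E_P[(Z : T -> R) \* \1_A] = 0].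

Lemma ge0_D0 (X : L0 P) : (0 <= X)%R -> D0 X.
Proof.
move=> /L0_leP X0 Z _.
pose f : {mfun T >-> R} :=
  (max_mfun (- L0rep X)%R (0 : {mfun T >-> R})%R * L0rep Z)%R.
suff f0 : \forall w \ae P, f w = (0 : {mfun T >-> R})%R w.
  rewrite (_ : _ \* _ = f :> (T -> R))%R; last by [].
  rewrite -(L0cls_Lfun P) (L0cls_eq f0) (L0cls_Lfun P).
  by have [] := Lfun_submod_closed P (lexx 1%E).
near=> w; transitivity (Num.max (- X w) 0 * Z w)%R; first by [].
have : (0 <= X w)%R by rewrite -(near (L0_0 P) w)// (near X0 w).
by rewrite -oppr_le0 => /max_idPr ->; rewrite mul0r.
Unshelve. all: by end_near. Qed.

End monotone_convex.

Section change_of_measure.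
Context d (T : measurableType d) (R : realType) (P Q : probability T R).
Local Open Scope ereal_scope.

Definition normalized_density (Z : L1 P) : Prop :=
  0 < 'E_P[Z] /\
  forall A, measurable A ->
    Q A = \int[P]_(w in A) (Z w / fine 'E_P[Z])%:E.

Definition L0proj (X : L0 P) : L0 Q := L0cls Q (L0rep X).

Variable phi0 : Linfty P -> R.

Definition MuQ : set (L0 Q) := L0proj @` Mu phi0.

(* By [luxemburgQ_proj], the choice of the representative is irrelevant. *)
Definition luxemburgQ (xi : L0 Q) : \bar R := luxemburg phi0 (L0cls P (L0rep xi)).

Lemma expectation_ae_eq (f g : {mfun T >-> R}) :
  (\forall w \ae P, f w = g w) -> 'E_P[f] = 'E_P[g].
Proof.
move=> fg; rewrite unlock; apply: ae_eq_integral => //.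
- exact/measurable_EFinP.
- exact/measurable_EFinP.
- by apply: filterS fg => w -> _.
Qed.

Lemma normalized_density_ae (Z : L1 P) (p : T -> Prop) : normalized_density Z ->
  (\forall w \ae P, p w) -> \forall w \ae Q, p w.
Proof.
move=> [_ QE] [A [mA PA0 pA]]; exists A; split => //.
rewrite QE// null_set_integral//; apply/measurable_EFinP/measurable_funM => //.
exact: measurable_funTS.
Qed.

Lemma expectation_mul_indic (Z : T -> R) (A : set T) : measurable A ->
  'E_P[Z \* \1_A] = \int[P]_(w in A) (Z w)%:E.
Proof.
move=> mA; rewrite unlock [RHS]integral_mkcond; apply: eq_integral => w _ /=.
by rewrite epatch_indic/= EFinM.
Qed.

Lemma dominating_ae (Zhat Z : L1 P) (X Y : L0 P) :
  dominating phi0 Zhat -> normalized_density Zhat -> dom_conjugate phi0 Z ->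
  (\forall w \ae Q, X w = Y w) ->
  \forall w \ae P, (X w * Z w = Y w * Z w)%R.
Proof.
move=> [_ _ dom] [E0 QE] domZ [N [mN QN0 XYN]].
have intZ (W : L1 P) B : measurable B ->
    P.-integrable B (EFin \o (W : T -> R)).
  move=> mB; apply: (integrableS measurableT) => //.
  by apply/Lfun1_integrable; exact: (valP W).
have Efin : 'E_P[Zhat] \is a fin_num.
  by apply: expectation_fin_num; exact: (valP Zhat).
have c0 : (0 < fine 'E_P[Zhat])%R.
  by rewrite fine_gt0// E0/= ltey_eq Efin.
have ZN B : B `<=` N -> measurable B -> \int[P]_(w in B) (Z w)%:E = 0.
  move=> BN mB; rewrite -expectation_mul_indic//; apply: dom => //.
  rewrite expectation_mul_indic//.
  have : Q B = 0.
    by apply/eqP; rewrite eq_le measure_ge0 andbT -QN0 le_measure// inE.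
  rewrite QE//; under eq_integral do rewrite mulrC EFinM.
  rewrite integralZl//; last exact: intZ.
  move=> /eqP; rewrite mule_eq0 eqe invr_eq0 gt_eqF//= => /eqP.
  by [].
have : ae_eq P N (EFin \o (Z : T -> R)) (cst 0).
  apply: integral_ae_eq => //; first exact: intZ.
  by move=> B BN mB; rewrite ZN// integral0.
apply: filterS => w ZN0; have [->//|XYw] := eqVneq (X w) (Y w).
have /ZN0[->] : N w by apply: XYN => /= XY; rewrite XY eqxx in XYw.
by rewrite !mulr0.
Qed.

Lemma phihat_ae_eqQ (Zhat : L1 P) (X Y : L0 P) :
  dominating phi0 Zhat -> normalized_density Zhat ->
  (\forall w \ae Q, X w = Y w) -> phihat phi0 X = phihat phi0 Y.
Proof.
move=> domZ dQ XY; congr ereal_sup; apply: eq_imagel => Z dZ; congr (_ - _).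
apply: (@expectation_ae_eq (L0rep X * L0rep Z)%R (L0rep Y * L0rep Z)%R).
by apply: filterS (dominating_ae domZ dQ dZ XY) => w.
Qed.

Lemma L0proj_cls (Z : L1 P) (f : {mfun T >-> R}) : normalized_density Z ->
  L0proj (L0cls P f) = L0cls Q f.
Proof.
by move=> dQ; apply: L0cls_eq; apply: (normalized_density_ae dQ); exact: L0clsE.
Qed.

Lemma luxemburgQ_proj (Zhat : L1 P) (X : L0 P) :
  dominating phi0 Zhat -> normalized_density Zhat ->
  luxemburgQ (L0proj X) = luxemburg phi0 X.
Proof.
move=> domZ dQ; congr (ereal_inf (image _ _)).
pose Y := L0cls P (L0rep (L0proj X)).
have XE (l : R) (W : L0 P) :
    \forall w \ae Q, ((l^-1 *: L0abs W : L0 P) w = l^-1 * `|W w|)%R.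
  apply: (normalized_density_ae dQ); near=> w.
  by rewrite (near (L0Z _ _) w)// (near (L0absE W) w).
have YX (l : R) : \forall w \ae Q, ((l^-1 *: L0abs Y : L0 P) w =
                  (l^-1 *: L0abs X : L0 P) w)%R.
  have YP := normalized_density_ae dQ (L0clsE P (L0rep (L0proj X))).
  near=> w; rewrite (near (XE l Y) w)// (near (XE l X) w)//.
  by rewrite (near YP w)// (near (L0clsE Q (L0rep X)) w).
by apply/seteqP; split=> l /= [l0 lX]; split=> //; move: lX;
  rewrite (phihat_ae_eqQ domZ dQ (YX l)).
Unshelve. all: by end_near. Qed.

End change_of_measure.

Arguments L0proj {d T R P} Q X.
Arguments MuQ {d T R P} Q phi0.
Arguments luxemburgQ {d T R P} Q phi0 xi.

(* Main.v *)
From HB Require Import structures.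
Require Import Defs.
From mathcomp Require Import all_boot all_order all_algebra.
From mathcomp Require Import all_classical all_reals all_analysis.
From mathcomp Require Import measurable_realfun ess_sup_inf.
From mathcomp Require Import ring lra.
Import Order.TTheory GRing.Theory Num.Theory numFieldNormedType.Exports.
Local Open Scope classical_set_scope.
Local Open Scope ring_scope.

(** Write [rho f] for [phihat |f|], that is the supremum over the effective
    domain of the conjugate of [\int |f| Z dP - phi0^*(Z)]. The elements of
    that domain are nonnegative ([dom_conjugate_ge0]) and vanish almost
    everywhere on [Q]-null sets ([ae_dominated]), so [rho] only sees [Q]-classes
    and is monotone for the [Q]-a.s. order. It is convex, and Fatou's lemma
    under each [Z dP] makes it lower semicontinuous along [Q]-a.s. convergence
    ([modular_le_lim]).

    Two facts use [phi0] itself. The Fenchel-Young inequality gives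
    [rho <= phi0] on nonnegative bounded functions, so by the Lebesgue property
    [rho (f n)] tends to [0] whenever [f n] is uniformly bounded and tends to
    [0] almost surely ([modular_le_bounded_cvg0]). Moreover [rho >= 0]: the
    convex function [phi0] dominates a linear functional
    ([exists_linear_minorant]), which is continuous along bounded pointwise
    limits because [phi0] is, hence is integration against some [Z] in [L1]
    ([lebesgue_functional_density]); at that [Z] the conjugate is null
    ([exists_conjugate_le0]). Without this last point even the zero function
    might fail to lie in [M_u].

    Everything else is the theory of modular spaces. An element of [M_u] can be
    cut at a level beyond which its tail is small; below that level the bounded
    case applies, which yields a dominated convergence theorem for [rho]
    ([heart_dominated_cvg0]) and with it order continuity and finiteness of the
    norm. Convexity of [{rho <= 1}] gives the triangle inequality, and
    [E[|f| Zhat] <= rho f + 1] gives definiteness. For completeness, a rapidly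
    Cauchy subsequence has increments that are summable against [Zhat dP], so it
    converges [Q]-a.s.; lower semicontinuity of [rho] turns this pointwise
    limit into a limit in norm, and the limit lies in [M_u] by the dominated
    convergence theorem ([heart_limit], [luxemburg_norm_complete]). *)

Set Implicit Arguments.
Unset Strict Implicit.
Unset Printing Implicit Defensive.

(** * Linear minorants of convex functions *)

Section linear_minorant.
Context (R : realType) (V : lmodType R).
Implicit Types (f g phi : V -> R) (x y : V) (r s : R).

Definition convex_null f : Prop := f 0 = 0 /\
  forall r x y, 0 <= r <= 1 ->
    f (r *: x + (1 - r) *: y) <= r * f x + (1 - r) * f y.

Lemma convex_null_scale f r x : convex_null f -> 0 <= r <= 1 ->
  f (r *: x) <= r * f x.
Proof.
by move=> [f0 cf] r01; have := cf r x 0 r01; rewrite scaler0 addr0 f0 mulr0 addr0.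
Qed.

Lemma convex_null_ge f x : convex_null f -> - f (- x) <= f x.
Proof.
move=> [f0 cf]; have := cf (2^-1) x (- x) _.
rewrite (_ : 1 - 2^-1 = 2^-1 :> R); last by lra.
rewrite scalerN subrr f0 => /(_ _)/wrap[]; first by lra.
lra.
Qed.

(** A chain of such functions stays above [x |-> - f (- x)] for each of its
    members [f], so its pointwise infimum is finite. *)
Lemma convex_null_chain_inf (A : set (V -> R)) f0 : A f0 ->
  (forall f, A f -> convex_null f) ->
  (forall f g, A f -> A g -> (forall x, f x <= g x) \/ (forall x, g x <= f x)) ->
  exists2 g, convex_null g & forall f, A f -> forall x, g x <= f x.
Proof.
move=> Af0 cA tA; pose S x := [set f x | f in A].
have Slb x : has_lbound (S x).
  exists (- f0 (- x)) => _ [f Af <-].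
  have [le|le] := tA _ _ Af Af0.
    have := convex_null_ge x (cA _ Af); have := le (- x); lra.
  have := convex_null_ge x (cA _ Af0); have := le x; lra.
have S0 x : S x !=set0 by exists (f0 x), f0.
have Sle f x : A f -> inf (S x) <= f x by move=> Af; apply: ge_inf => //; exists f.
exists (fun x => inf (S x)); last by move=> f Af x; exact: Sle.
split.
  apply/eqP; rewrite eq_le; apply/andP; split.
    by have := Sle _ 0 Af0; rewrite (cA _ Af0).1.
  by apply: lb_le_inf => // _ [f Af <-]; rewrite (cA _ Af).1.
move=> r x y /andP[r0 r1]; apply/ler_addgt0Pr => e e0.
have [_ [f Af <-] fx] := inf_adherent e0 (conj (S0 x) (Slb x)).
have [_ [g Ag <-] gy] := inf_adherent e0 (conj (S0 y) (Slb y)).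
suff [h [Ah hx hy]] : exists h,
    [/\ A h, h x <= inf (S x) + e & h y <= inf (S y) + e].
  apply: le_trans (Sle _ _ Ah) _.
  apply: le_trans ((cA _ Ah).2 _ _ _ _) _; first by rewrite r0 r1.
  nra.
have [le|le] := tA _ _ Af Ag.
  by exists f; split=> //; [exact: ltW|exact: le_trans (le _) (ltW gy)].
by exists g; split=> //; [exact: le_trans (le _) (ltW fx)|exact: ltW].
Qed.

Definition minimal_convex f : Prop := convex_null f /\
  forall g, convex_null g -> (forall x, g x <= f x) -> g = f.

(** Zorn's lemma. *)
Lemma exists_minimal_convex phi : convex_null phi ->
  exists2 f, minimal_convex f & forall x, f x <= phi x.
Proof.
move=> cphi.
pose S := {f : V -> R | convex_null f /\ forall x, f x <= phi x}.
pose le_S (f g : S) := `[< forall x, sval g x <= sval f x >].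
have [||||f fmin] := @Zorn S le_S.
- by move=> f; apply/asboolP.
- move=> f g h /asboolP fg /asboolP gh; apply/asboolP => x.
  exact: le_trans (gh x) (fg x).
- move=> [f Sf] [g Sg] /asboolP/= fg /asboolP/= gf.
  have fgE : f = g by apply/funext => x; apply/le_anti; rewrite fg gf.
  by subst g; congr exist; exact: Prop_irrelevance.
- move=> A tA.
  have [[f0 Af0]|A0] := pselect (A !=set0); last first.
    exists (exist _ phi (conj cphi (fun x => lexx _))) => f Af.
    by exfalso; apply: A0; exists f.
  have [|||g cg gle] := @convex_null_chain_inf [set sval f | f in A] (sval f0).
  - by exists f0.
  - by move=> _ [f Af <-]; have [] := svalP f.
  - move=> _ _ [f Af <-] [g Ag <-].
    by have [/asboolP ?|/asboolP ?] := tA _ _ Af Ag; [right|left].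
  have gphi x : g x <= phi x.
    by apply: le_trans (gle (sval f0) _ x) _; [exists f0|have [_] := svalP f0].
  exists (exist _ g (conj cg gphi)) => f Af; apply/asboolP => x /=.
  by apply: gle; exists f.
exists (sval f); last by have [] := svalP f.
split; first by have [] := svalP f.
move=> g cg gf.
have gphi x : g x <= phi x by apply: le_trans (gf x) _; have [_] := svalP f.
by have /(congr1 sval) := fmin (exist _ g (conj cg gphi)) (asboolT gf).
Qed.

(** For [0 < r <= 1], convexity gives [f (r x) / r <= f x]; the left-hand side
    is again a competitor, so minimality forces equality. *)
Lemma minimal_convex_homogeneous f r x : minimal_convex f -> 0 <= r ->
  f (r *: x) = r * f x.
Proof.
move=> [cf fmin].
have small s y : 0 < s -> s <= 1 -> f (s *: y) = s * f y.
  move=> s0 s1; rewrite -[in RHS](fmin (fun z => s^-1 * f (s *: z))).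
  - by rewrite mulrA divff ?mul1r// gt_eqF.
  - split=> [|p z w p01]; first by rewrite scaler0 cf.1 mulr0.
    rewrite scalerDr !scalerA (mulrC s p) (mulrC s (1 - p)) -!scalerA.
    rewrite (_ : p * _ + _ = s^-1 * (p * f (s *: z) + (1 - p) * f (s *: w))).
      by apply: ler_wpM2l; [rewrite invr_ge0 ltW|exact: cf.2].
    by ring.
  - move=> z; rewrite ler_pdivrMl//; apply: convex_null_scale => //.
    by rewrite s1 ltW.
rewrite le_eqVlt => /predU1P[<-|r0]; first by rewrite scale0r mul0r cf.1.
have [r1|r1] := leP r 1; first exact: small.
rewrite -[in RHS](scalerK (lt0r_neq0 r0) x) [in RHS]small ?invr_gt0//.
  by rewrite mulrA divff ?mul1r// gt_eqF.
by rewrite invf_le1// ltW.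
Qed.

Lemma minimal_convex_subadditive f x y : minimal_convex f ->
  f (x + y) <= f x + f y.
Proof.
move=> mf; have := mf.1.2 2^-1 x y _.
rewrite (_ : 1 - 2^-1 = 2^-1 :> R); last by lra.
rewrite -scalerDr -mulrDr minimal_convex_homogeneous// => /(_ _)/wrap[].
  by lra.
lra.
Qed.

(** The function [x |-> inf_(s >= 0) (f (x + s y) - s f y)] is again a
    competitor, below [f] by the choice [s = 0]; minimality makes them equal,
    and the choice [s = 1] then gives superadditivity. *)
Lemma minimal_convex_additive f x y : minimal_convex f ->
  f (x + y) = f x + f y.
Proof.
move=> mf; apply/le_anti; rewrite minimal_convex_subadditive//=.
have [cf fmin] := mf.
pose S z := [set f (z + s *: y) - s * f y | s in [set s : R | 0 <= s]].
have Slb z : has_lbound (S z).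
  exists (- f (- z)) => _ [s s0 <-].
  have := minimal_convex_subadditive (z + s *: y) (- z) mf.
  rewrite addrAC subrr add0r minimal_convex_homogeneous//; lra.
have S0 z : S z !=set0 by exists (f (z + 0 *: y) - 0 * f y), 0 => /=.
have Sle s z : 0 <= s -> inf (S z) <= f (z + s *: y) - s * f y.
  by move=> s0; apply: ge_inf => //; exists s.
have qle z : inf (S z) <= f z.
  by have := Sle 0 z (lexx _); rewrite scale0r addr0 mul0r subr0.
suff cq : convex_null (fun z => inf (S z)).
  have /(congr1 (@^~ x)) /= <- := fmin _ cq qle.
  by have := Sle 1 x ler01; rewrite scale1r mul1r; lra.
split.
  apply/eqP; rewrite eq_le; apply/andP; split; first by rewrite -cf.1; exact: qle.
  apply: lb_le_inf => // _ [s s0 <-].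
  by rewrite add0r minimal_convex_homogeneous// subrr.
move=> r z w /andP[r0 r1]; apply/ler_addgt0Pr => e e0.
have [_ [s s0 <-] fz] := inf_adherent e0 (conj (S0 z) (Slb z)).
have [_ [t t0 <-] fw] := inf_adherent e0 (conj (S0 w) (Slb w)).
have rst : 0 <= r * s + (1 - r) * t.
  by rewrite addr_ge0// mulr_ge0// subr_ge0.
apply: le_trans (Sle _ _ rst) _.
have -> : r *: z + (1 - r) *: w + (r * s + (1 - r) * t) *: y =
    r *: (z + s *: y) + (1 - r) *: (w + t *: y).
  by rewrite !scalerDr (scalerDl y) !scalerA addrACA.
have := cf.2 r (z + s *: y) (w + t *: y) _; rewrite r0 r1 => /(_ isT).
nra.
Qed.

(** Hahn-Banach, in the form of a linear functional below a convex one: a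
    minimal convex function is linear. *)
Lemma exists_linear_minorant phi : convex_null phi ->
  exists2 l : V -> R, (forall r x y, l (r *: x + y) = r * l x + l y) &
    forall x, l x <= phi x.
Proof.
move=> /exists_minimal_convex[f mf fphi]; exists f => // r x y.
rewrite minimal_convex_additive//; congr (_ + _).
have [r0|r0] := leP 0 r; first exact: minimal_convex_homogeneous.
have := minimal_convex_additive (r *: x) ((- r) *: x) mf.
rewrite scaleNr subrr mf.1.1 -scaleNr.
by rewrite (@minimal_convex_homogeneous _ (- r) x mf) ?oppr_ge0 1?ltW//; lra.
Qed.

End linear_minorant.

(** * Functionals with the Lebesgue property are densities *)

Section bounded_measurable.
Context d (T : measurableType d) (R : realType).
Implicit Types (f g : T -> R) (A : set T) (a : R).

Definition bounded_measurable f : Prop :=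
  measurable_fun [set: T] f /\ exists M : R, forall w, `|f w| <= M.

Lemma bounded_measurable_indic A : measurable A ->
  bounded_measurable (\1_A : T -> R).
Proof.
move=> mA; split; first exact: measurable_indic.
by exists 1 => w; rewrite indicE ger0_norm// lern1 leq_b1.
Qed.

Lemma bounded_measurable_cst a : bounded_measurable (fun=> a : R).
Proof. by split; [exact: measurable_cst|exists `|a|]. Qed.

Lemma bounded_measurable_lin a f g : bounded_measurable f ->
  bounded_measurable g -> bounded_measurable (fun w => a * f w + g w).
Proof.
move=> [mf [M fM]] [mg [K gK]]; split.
  by apply: measurable_funD => //; exact: measurable_funM.
exists (`|a| * M + K) => w; apply: le_trans (ler_normD _ _) _.
by apply: lerD => //; rewrite normrM ler_wpM2l.
Qed.

Lemma bounded_measurable_lim (f : nat -> T -> R) g (M : R) :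
  (forall n, measurable_fun [set: T] (f n)) -> (forall n w, `|f n w| <= M) ->
  (forall w, f n w @[n --> \oo] --> g w) ->
  bounded_measurable g /\ forall w, `|g w| <= M.
Proof.
move=> mf fM fg.
have gM w : `|g w| <= M.
  have /cvg_norm ng := fg w; apply: (cvgr_to_le ng).
  by apply: nearW => n; exact: fM.
split=> //; split; last by exists M.
by apply: (measurable_fun_cvg mf) => w _; exact: fg.
Qed.

Lemma bounded_measurable_integrable (mu : {measure set T -> \bar R}) f g :
  mu.-integrable [set: T] (EFin \o g) -> bounded_measurable f ->
  mu.-integrable [set: T] (fun w => (f w * g w)%:E).
Proof.
move=> ig [mf [M fM]].
apply: (@integrableMr _ _ _ mu _ measurableT f (EFin \o g)) => //.
exists M; split; first exact: num_real.
by move=> K MK w _ /=; exact: le_trans (fM w) (ltW MK).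
Qed.

End bounded_measurable.

Section density.
Local Open Scope charge_scope.
Local Open Scope ring_scope.
Import HBNNSimple.
Context d (T : measurableType d) (R : realType) (P : probability T R).
Variable L : (T -> R) -> R.
Hypothesis L_lin : forall a f g, bounded_measurable f -> bounded_measurable g ->
  L (fun w => a * f w + g w) = a * L f + L g.
Hypothesis L_cvg : forall (f : nat -> T -> R) (g : T -> R) (M : R),
  (forall n, measurable_fun [set: T] (f n)) -> (forall n w, `|f n w| <= M) ->
  (forall w, f n w @[n --> \oo] --> g w) -> L (f n) @[n --> \oo] --> L g.
Hypothesis L_null : forall A, measurable A -> P A = 0%E -> L \1_A = 0.

Definition indic_functional (A : set T) : \bar R := (L \1_A)%:E.

Let indic_functional0 : indic_functional set0 = 0%E.
Proof. by rewrite /indic_functional L_null// measure0. Qed.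

Let indic_functional_fin A : measurable A -> indic_functional A \is a fin_num.
Proof. by []. Qed.

Let indic_functional_sigma : semi_sigma_additive indic_functional.
Proof.
move=> F mF tF mUF.
have sumE n : (\sum_(0 <= i < n) indic_functional (F i))%E =
    (L \1_(\bigcup_(i < n) F i))%:E.
  elim: n => [|n IH].
    by rewrite big_nil bigcup_mkord big_ord0 L_null ?measure0.
  rewrite big_nat_recr//= IH -EFinD; congr EFin.
  have mU : measurable (\bigcup_(i < n) F i) by exact: bigcup_measurable.
  rewrite addrC -[L \1_(F n)]mul1r -L_lin//; try exact: bounded_measurable_indic.
  congr L; apply/funext => w; rewrite mul1r.
  have -> : \bigcup_(i < n.+1) F i = \bigcup_(i < n) F i `|` F n.
    by rewrite !bigcup_mkord big_ord_recr.
  rewrite !indicE in_setU; case: (boolP (w \in F n)) => [|_]; last first.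
    by rewrite orbF add0r.
  rewrite inE => Fnw; rewrite orbT memNset ?addr0// => -[i /= ilen Fiw].
  have /trivIsetP/(_ i n I I) := tF; rewrite neq_ltn ilen => /(_ isT).
  by move/seteqP => [+ _] => /(_ w); apply.
under eq_cvg do rewrite sumE.
apply: cvg_EFin; first exact: nearW.
apply: (@L_cvg _ _ 1).
- by move=> n; apply: measurable_indic; exact: bigcup_measurable.
- by move=> n w; rewrite indicE ger0_norm// lern1 leq_b1.
move=> w; have [[N _ FNw]|nF] := pselect ((\bigcup_n F n) w); last first.
  apply: cvg_near_cst; apply: nearW => n; rewrite !indicE !memNset//.
  by move=> [i _ Fiw]; apply: nF; exists i.
apply: cvg_near_cst; near=> n; rewrite !indicE !mem_set//; first by exists N.
by exists N => //=; near: n; exists N.+1.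
Unshelve. all: by end_near. Qed.

HB.instance Definition _ := isCharge.Build _ T R indic_functional
  indic_functional0 indic_functional_fin indic_functional_sigma.

Let dominated : indic_functional `<< P.
Proof.
move=> A A0 B mB BA; rewrite /indic_functional L_null//.
exact: A0.
Qed.

Let Z : T -> R := fine \o ('d indic_functional '/d P).

Let ZE : EFin \o Z = ('d indic_functional '/d P).
Proof. by apply/funext => w /=; rewrite fineK// Radon_Nikodym_fin_num. Qed.

Let intZ : P.-integrable [set: T] (EFin \o Z).
Proof. by rewrite ZE; exact: Radon_Nikodym_integrable. Qed.

Let intMZ f : bounded_measurable f ->
  P.-integrable [set: T] (fun w => (f w * Z w)%:E).
Proof. exact: bounded_measurable_integrable. Qed.

Let repr f := bounded_measurable f /\ (L f)%:E = (\int[P]_w (f w * Z w)%:E)%E.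

Let repr_indic A : measurable A -> repr (\1_A : T -> R).
Proof.
move=> mA; split; first exact: bounded_measurable_indic.
transitivity (indic_functional A) => //.
rewrite (Radon_Nikodym_integral dominated mA) -ZE integral_mkcond.
by apply: eq_integral => w _; rewrite epatch_indic/= mulrC EFinM.
Qed.

Let repr_lin a f g : repr f -> repr g -> repr (fun w => a * f w + g w).
Proof.
move=> [bf fE] [bg gE]; split; first exact: bounded_measurable_lin.
rewrite L_lin// EFinD EFinM fE gE -integralZl//; last exact: intMZ.
rewrite -integralD//; [|by apply: integrableZl => //; exact: intMZ|exact: intMZ].
by apply: eq_integral => w _; rewrite -EFinM -EFinD mulrDl mulrA.
Qed.

Let repr_cvg (f : nat -> T -> R) (g : T -> R) (M : R) : (forall n, repr (f n)) ->
  bounded_measurable g -> (forall n w, `|f n w| <= M) ->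
  (forall w, f n w @[n --> \oo] --> g w) -> repr g.
Proof.
move=> rf bg fM fg; split=> //.
have Lf : (L (f n))%:E @[n --> \oo] --> (L g)%:E.
  apply: cvg_EFin; first exact: nearW.
  by apply: (L_cvg (M := M)) => // n; have [[]] := rf n.
apply: (cvg_unique _ Lf) => //=.
under eq_cvg do rewrite (rf _).2.
have [|||||_ _] // := @dominated_convergence _ _ _ P _ measurableT
  (fun n w => (f n w * Z w)%:E) (fun w => (g w * Z w)%:E)
  (fun w => (M%:E * `|(EFin \o Z) w|)%E).
- by move=> n; have := measurable_int _ (intMZ (rf n).1).
- by have := measurable_int _ (intMZ bg).
- apply: aeW => w _; apply: cvg_EFin; first exact: nearW.
  by apply: cvgMr_tmp; exact: fg.
- by apply: integrableZl => //; exact: integrable_abse.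
- apply: aeW => w n _ /=.
  by rewrite -EFinM lee_fin normrM ler_wpM2r.
Qed.

Let repr_ge0 f : bounded_measurable f -> (forall w, 0 <= f w) -> repr f.
Proof.
move=> [mf [M fM]] f0.
have mEf : measurable_fun [set: T] (EFin \o f) by exact/measurable_EFinP.
have Ef0 w : [set: T] w -> (0 <= (EFin \o f) w)%E by rewrite lee_fin.
pose h n : {nnsfun T >-> R} := nnsfun_approx measurableT mEf n.
apply: (@repr_cvg (fun n => h n : T -> R) f M) => //.
- move=> n.
  suff H (s : seq R) : repr (fun w => \sum_(y <- s) (y * \1_(h n @^-1` [set y]) w)).
    pose s := finmap.enum_fset (fset_set (range (h n))).
    rewrite (_ : (h n : T -> R) =
      fun w => \sum_(y <- s) (y * \1_(h n @^-1` [set y]) w)); first exact: H.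
    by apply/funext => w; rewrite {1}fimfunE fsbig_finite.
  elim: s => [|y s IH].
    under eq_fun do rewrite big_nil.
    have := repr_indic measurable0.
    by rewrite (_ : \1_set0 = fun=> 0)//; apply/funext => w; rewrite indic0.
  under eq_fun do rewrite big_cons.
  by apply: repr_lin => //; exact: repr_indic.
- by split=> //; exists M.
- move=> n w; rewrite ger0_norm//; apply: le_trans (le_trans (ler_norm _) (fM w)).
  by rewrite -lee_fin /h nnsfun_approxE; exact: le_approx.
- by move=> w; have := cvg_nnsfun_approx measurableT mEf Ef0 I (x := w);
    move=> /fine_cvgP[].
Qed.

(** The density is the Radon-Nikodym derivative of the signed measure
    [A |-> L \1_A], which is countably additive because [L] is continuous along
    bounded pointwise limits. *)
Lemma lebesgue_functional_density : exists2 Z : T -> R,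
  P.-integrable [set: T] (EFin \o Z) &
  forall f, bounded_measurable f -> (L f)%:E = (\int[P]_w (f w * Z w)%:E)%E.
Proof.
exists Z => // f bf; have [mf [M fM]] := bf.
have rM : repr (fun=> M).
  apply: repr_ge0 => [|w]; first exact: bounded_measurable_cst.
  exact: le_trans (fM w).
have rMf : repr (fun w => M + f w).
  apply: repr_ge0 => [|w].
    have := bounded_measurable_lin 1 (bounded_measurable_cst T M) bf.
    by under eq_fun do rewrite mul1r.
  by have := fM w; rewrite ler_norml; lra.
have [_] := repr_lin (-1) rM rMf.
by under eq_fun do rewrite mulN1r addKr; under eq_integral do rewrite mulN1r addKr.
Qed.

End density.

(** * The conjugate *)

Section Linfty_class.
Context d (T : measurableType d) (R : realType) (P : probability T R).
Implicit Types (f g : T -> R) (X Y : Linfty P).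

(** Choosing a class makes the passage from functions to [L^oo] total, so that
    bounds need not be carried in types. *)
Definition Linfty_class f : Linfty P :=
  xget 0 [set X : Linfty P | \forall w \ae P, X w = f w].

Lemma Linfty_class_spec f : (exists X : Linfty P, \forall w \ae P, X w = f w) ->
  \forall w \ae P, Linfty_class f w = f w.
Proof. exact: xgetPex. Qed.

Lemma Linfty_eq X Y : (\forall w \ae P, X w = Y w) -> X = Y.
Proof. by move=> XY; apply/val_inj/L0_eqP. Qed.

Lemma Lnorm_le_bound f (M : R) : (\forall w \ae P, `|f w| <= M) ->
  ('N[P]_+oo[EFin \o f] <= M%:E)%E.
Proof.
move=> fM; rewrite unlock/= probability_setT lte01.
by apply/ess_supP; apply: filterS fM => w /=; rewrite lee_fin.
Qed.

Lemma Linfty_classE f : bounded_measurable f ->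
  \forall w \ae P, Linfty_class f w = f w.
Proof.
move=> [mf [M fM]]; apply: Linfty_class_spec.
pose F : {mfun T >-> R} := mfun_Sub (mem_set mf).
have Fin : L0cls P F \in LpL0 (mu := P) (leey 1%E).
  rewrite -topredE/= /LpL0 L0cls_Lfun; apply/andP; split; apply/mem_set => //=.
  by apply: le_lt_trans (Lnorm_le_bound (M := M) _) (ltry _); exact: nearW.
by exists (Sub (L0cls P F) Fin : Linfty P); exact: (L0clsE P F).
Qed.

Lemma Linfty_class_lin a f g : bounded_measurable f -> bounded_measurable g ->
  Linfty_class (fun w => a * f w + g w) =
  a *: Linfty_class f + Linfty_class g.
Proof.
move=> bf bg; apply: Linfty_eq; near=> w.
rewrite [RHS](near (L0D (a *: (Linfty_class f : L0 P)) (Linfty_class g)) w)//.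
rewrite (near (L0Z a (Linfty_class f : L0 P)) w)//.
rewrite (near (Linfty_classE (bounded_measurable_lin a bf bg)) w)//.
by rewrite (near (Linfty_classE bf) w)// (near (Linfty_classE bg) w).
Unshelve. all: by end_near. Qed.

Lemma Linfty_class_id X f : (\forall w \ae P, f w = X w) ->
  Linfty_class f = X.
Proof.
move=> fX; apply: Linfty_eq.
have : \forall w \ae P, Linfty_class f w = f w.
  by apply: Linfty_class_spec; exists X; apply: filterS fX.
by apply: filterS2 fX => w -> ->.
Qed.

Lemma Linfty_bounded X : exists2 f, bounded_measurable f &
  \forall w \ae P, f w = X w.
Proof.
have /andP[_] := valP X; rewrite inE/= /finite_norm unlock/= probability_setT lte01.
move=> /(@ess_supr_bounded _ _ _ P (Num.norm \o (X : T -> R)))[M XM].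
pose f w := Num.max (- M) (Num.min (X w) M).
exists f.
  split.
    by apply: measurable_maxr => //; exact: measurable_minr.
  exists `|M| => w; rewrite /f ler_norml.
  have [?|?] := leP (X w) M; have [?|?] := leP (- M) _;
    by have := ler_norm M; have := ler_norm (- M); rewrite normrN; lra.
apply: filterS XM => w; rewrite /f /= ler_norml => /andP[? ?].
by rewrite min_l// max_r.
Qed.

End Linfty_class.

Section conjugate.
Context d (T : measurableType d) (R : realType) (P : probability T R).
Variable phi0 : Linfty P -> R.
Hypothesis phi0_convex : monotone_convex phi0.
Hypothesis phi0_lebesgue : lebesgue_property phi0.
Hypothesis phi0_0 : phi0 0 = 0.
Implicit Types (f g : T -> R) (Z : L1 P).

Lemma lebesgue_cvg (f : nat -> T -> R) g M :
  (forall n, measurable_fun [set: T] (f n)) -> (forall n w, `|f n w| <= M) ->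
  (forall w, f n w @[n --> \oo] --> g w) ->
  phi0 (Linfty_class P (f n)) @[n --> \oo] --> phi0 (Linfty_class P g).
Proof.
move=> mf fM fg.
have bf n : bounded_measurable (f n) by split=> //; exists M.
have [bg _] := bounded_measurable_lim mf fM fg.
apply: phi0_lebesgue.
  apply: le_lt_trans (ltry M); apply: ge_ereal_sup => _ [n _ <-].
  apply: Lnorm_le_bound; apply: filterS (Linfty_classE P (bf n)) => w ->.
  exact: fM.
have fE : \forall w \ae P, forall n, Linfty_class P (f n) w = f n w.
  by apply: ae_foralln => n; exact: Linfty_classE.
apply: filterS2 fE (Linfty_classE P bg) => w fnE ->.
by under eq_cvg do rewrite fnE; exact: fg.
Qed.

Lemma conjugate_ge0 Z : (0 <= conjugate phi0 Z)%E.
Proof.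
apply: ereal_sup_ubound; exists 0 => //.
rewrite phi0_0 sube0; transitivity ('E_P[cst 0%R])%E; last exact: expectation_cst.
apply: (@expectation_ae_eq _ _ _ P (L0rep (0 : L0 P) * L0rep Z) (cst 0)).
apply: filterS (L0_0 P) => w w0.
by change (L0rep (0 : L0 P) w * L0rep Z w = 0); rewrite w0 mul0r.
Qed.

Lemma conjugate_fin Z : dom_conjugate phi0 Z ->
  conjugate phi0 Z = (fine (conjugate phi0 Z))%:E.
Proof.
by move=> dZ; rewrite fineK// ge0_fin_numE// conjugate_ge0.
Qed.

Lemma bounded_mul_integrable f Z : bounded_measurable f ->
  P.-integrable [set: T] (fun w => (f w * Z w)%:E).
Proof.
apply: bounded_measurable_integrable.
by apply/Lfun1_integrable; exact: (valP Z).
Qed.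

Lemma fenchel_young f Z : bounded_measurable f ->
  (\int[P]_w (f w * Z w)%:E <= (phi0 (Linfty_class P f))%:E + conjugate phi0 Z)%E.
Proof.
move=> bf; rewrite addeC -leeBlDr//.
apply: ereal_sup_ubound; exists (Linfty_class P f) => //; congr (_ - _)%E.
rewrite unlock; apply: ae_eq_integral => //.
- by apply/measurable_EFinP/measurable_funM; exact: measurable_funP.
- by have := measurable_int _ (bounded_mul_integrable Z bf).
- by apply: filterS (Linfty_classE P bf) => w /= ->.
Qed.

Lemma phi0_mono f g : bounded_measurable f -> bounded_measurable g ->
  (forall w, f w <= g w) -> phi0 (Linfty_class P f) <= phi0 (Linfty_class P g).
Proof.
move=> bf bg fg; apply: phi0_convex.2; apply/L0_leP.
by apply: filterS2 (Linfty_classE P bf) (Linfty_classE P bg) => w -> ->.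
Qed.

Lemma Linfty_class0 : Linfty_class P (fun=> 0) = 0.
Proof. by apply: Linfty_class_id; apply: filterS (L0_0 P) => w ->. Qed.

(** Testing with [- n 1_{Z < 0}], where [phi0 <= 0] by monotonicity, forces
    the negative part of [Z] to be null. *)
Lemma dom_conjugate_ge0 Z : dom_conjugate phi0 Z -> \forall w \ae P, 0 <= Z w.
Proof.
move=> dZ; pose A := [set w | Z w < 0].
have mZ : measurable_fun [set: T] (Z : T -> R) by exact: measurable_funP.
have mA : measurable A.
  rewrite (_ : A = [set: T] `&` (Z : T -> R) @^-1` `]-oo, 0[%classic).
    by apply: mZ => //; exact: measurable_itv.
  by apply/seteqP; split=> w /=; rewrite in_itv/=; [split|case].
have bA := bounded_measurable_indic R mA.
pose f : T -> R := fun w => - \1_A w.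
have fE : f = (fun w => -1 * \1_A w + 0) by apply/funext => w; rewrite addr0 mulN1r.
have bf : bounded_measurable f.
  by rewrite fE; exact: (bounded_measurable_lin _ bA (bounded_measurable_cst _ 0)).
pose J := fine (\int[P]_w (f w * Z w)%:E)%E.
have JE : (\int[P]_w (f w * Z w)%:E)%E = J%:E.
  by rewrite fineK//; apply: integrable_fin_num => //; exact: bounded_mul_integrable.
have fZ0 w : 0 <= f w * Z w.
  rewrite /f indicE; have [|] := boolP (w \in A).
    by rewrite inE /A/= => /ltW; rewrite mulN1r oppr_ge0.
  by rewrite oppr0 mul0r.
have nJ n : n%:R * J <= fine (conjugate phi0 Z).
  have bnf : bounded_measurable (fun w => n%:R * f w + 0).
    exact: (bounded_measurable_lin _ bf (bounded_measurable_cst _ 0)).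
  have := fenchel_young Z bnf.
  under eq_integral do rewrite addr0 -mulrA EFinM.
  rewrite integralZl//; last exact: bounded_mul_integrable.
  rewrite JE (conjugate_fin dZ) -EFinM -EFinD lee_fin => /le_trans; apply.
  rewrite gerDr [leRHS](_ : 0 = phi0 (Linfty_class P (fun=> 0))); last first.
    by rewrite Linfty_class0.
  apply: phi0_mono => //; first exact: bounded_measurable_cst.
  by move=> w; rewrite addr0 mulrN oppr_le0 mulr_ge0// indicE ler0n.
have J0 : J = 0.
  apply/eqP; rewrite eq_le; apply/andP; split; last first.
    by rewrite fine_ge0// integral_ge0// => w _; rewrite lee_fin.
  rewrite leNgt; apply/negP => Jgt0.
  pose c := fine (conjugate phi0 Z).
  have c0 : 0 <= c by rewrite fine_ge0// conjugate_ge0.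
  have := nJ (Num.truncn (c / J)).+1.
  rewrite leNgt => /negP; apply.
  by rewrite -ltr_pdivrMr// truncnS_gt.
have : ae_eq P [set: T] (fun w => (f w * Z w)%:E) (cst 0%E).
  apply/ae_eq_integral_abs => //.
    by have := measurable_int _ (bounded_mul_integrable Z bf).
  under eq_integral do rewrite gee0_abs ?lee_fin ?fZ0//.
  by rewrite JE J0.
apply: filterS => w /= /(_ I)[]; rewrite /f indicE.
have [|] := boolP (w \in A); last first.
  by rewrite notin_setE /A/= => /negP; rewrite -leNgt.
by rewrite inE /A/= mulN1r => + /eqP; rewrite oppr_eq0 => /lt_eqF ->.
Qed.

Lemma phi0_convex_null : convex_null phi0.
Proof.
split=> // r x y /andP[r0 r1].
by have := phi0_convex.1 (Itv01 r0 r1) x y; rewrite !inE => /(_ I I).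
Qed.

(** The linear minorant [l] of [phi0] inherits continuity from
    [l X <= phi0 X] and [- l X = l (- X) <= phi0 (- X)], hence has a density,
    at which the conjugate vanishes. *)
Lemma exists_conjugate_le0 : exists Z, (conjugate phi0 Z <= 0)%E.
Proof.
have [l l_lin l_phi0] := exists_linear_minorant phi0_convex_null.
pose L f := l (Linfty_class P f).
have L_lin a f g : bounded_measurable f -> bounded_measurable g ->
    L (fun w => a * f w + g w) = a * L f + L g.
  by move=> bf bg; rewrite /L Linfty_class_lin// l_lin.
have L0 : L (fun=> 0) = 0.
  by rewrite /L Linfty_class0; have := l_lin 1 0 0; rewrite scale1r addr0 mul1r; lra.
have LN f : bounded_measurable f -> L (fun w => - f w) = - L f.
  move=> bf; have := L_lin (-1) f (fun=> 0) bf (bounded_measurable_cst _ _).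
  by under eq_fun do rewrite mulN1r addr0; rewrite L0 mulN1r addr0.
have L_cvg0 (f : nat -> T -> R) M : (forall n, measurable_fun [set: T] (f n)) ->
    (forall n w, `|f n w| <= M) -> (forall w, f n w @[n --> \oo] --> 0) ->
    L (f n) @[n --> \oo] --> 0.
  move=> mf fM f0; have bf n : bounded_measurable (f n) by split=> //; exists M.
  have cp : phi0 (Linfty_class P (f n)) @[n --> \oo] --> 0.
    by rewrite -phi0_0 -Linfty_class0; exact: (lebesgue_cvg mf fM).
  have cn : - phi0 (Linfty_class P (fun w => - f n w)) @[n --> \oo] --> 0.
    rewrite -oppr0; apply: cvgN; rewrite -phi0_0 -Linfty_class0.
    apply: (@lebesgue_cvg (fun n w => - f n w) _ M).
    - by move=> n; exact: measurable_funN.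
    - by move=> n w; rewrite normrN.
    - by move=> w; rewrite -oppr0; apply: cvgN; exact: f0.
  apply: (squeeze_cvgr _ cn cp); apply: nearW => n; rewrite l_phi0 andbT.
  by rewrite lerNl -LN ?l_phi0.
have [||A mA PA0|Z iZ LZ] := @lebesgue_functional_density _ _ _ P L.
- by [].
- move=> f g M mf fM fg.
  have bf n : bounded_measurable (f n) by split=> //; exists M.
  have [bg gM] := bounded_measurable_lim mf fM fg.
  have LE n : L (f n) = L (fun w => 1 * f n w - g w) + L g.
    have := L_lin 1 (f n) (fun w => - g w).
    rewrite LN// => ->//; first by rewrite mul1r subrK.
    by have := bounded_measurable_lin (-1) bg (bounded_measurable_cst _ 0);
      under eq_fun do rewrite mulN1r addr0.
  rewrite (funext LE : (fun n => L (f n)) = _) -[L g in X in _ --> X]add0r.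
  apply: cvgD; last exact: cvg_cst.
  apply: (@L_cvg0 _ (M + M)).
  - move=> n; apply: measurable_funB; last exact: bg.1.
    by apply: measurable_funM.
  - by move=> n w; rewrite mul1r; apply: le_trans (ler_normB _ _) (lerD _ _).
  - move=> w; rewrite -(subrr (g w)); apply: cvgB; last exact: cvg_cst.
    by under eq_cvg do rewrite mul1r; exact: fg.
- rewrite -L0 /L; congr l.
  apply: Linfty_class_id.
  have AC : \forall w \ae P, ~ A w by exists A; split=> // w /=; rewrite notK.
  have b0 := bounded_measurable_cst T (0 : R).
  apply: filterS2 AC (Linfty_classE P b0) => w nA ->.
  by rewrite indicE memNset.
have /Lfun1_integrable ZL1 := iZ.
pose F : {mfun T >-> R} := mfun_Sub (sub_Lfun_mfun ZL1).
have Fin : L0cls P F \in LpL0 (mu := P) (lexx 1%E).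
  by rewrite -topredE/= /LpL0 L0cls_Lfun.
exists (Sub (L0cls P F) Fin : L1 P); apply: ge_ereal_sup => _ [X _ <-].
have [f bf fX] := Linfty_bounded X.
rewrite leeBlDr// add0e; apply: le_trans (_ : (L f)%:E <= _)%E; last first.
  by rewrite lee_fin /L (Linfty_class_id fX).
rewrite LZ// unlock le_eqVlt; apply/orP; left; apply/eqP.
apply: ae_eq_integral => //.
- by apply/measurable_EFinP/measurable_funM; exact: measurable_funP.
- apply/measurable_EFinP/measurable_funM; first exact: bf.1.
  by have /measurable_EFinP := measurable_int _ iZ.
- by apply: filterS2 fX (L0clsE P F) => w /= -> ->.
Qed.

End conjugate.

(** * The modular *)

Section ereal_cvg0.
Context (R : realType).

Lemma cvge0_squeeze (u : nat -> \bar R) : (forall n, 0 <= u n)%E ->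
  (forall e : R, 0 < e -> \forall n \near \oo, (u n <= e%:E)%E) ->
  u n @[n --> \oo] --> 0%E.
Proof.
move=> u0 ue; have fin : \forall n \near \oo, u n \is a fin_num.
  apply: filterS (ue 1 ltr01) => n un.
  by rewrite ge0_fin_numE// (le_lt_trans un (ltry _)).
apply/fine_cvgP; split=> //; apply/cvgrPdist_le => e e0.
apply: filterS2 fin (ue e e0) => n fn un.
by rewrite sub0r normrN ger0_norm ?fine_ge0// -lee_fin fineK.
Qed.

End ereal_cvg0.

Section modular.
Context d (T : measurableType d) (R : realType) (P : probability T R).
Variable phi0 : Linfty P -> R.
Hypothesis phi0_convex : monotone_convex phi0.
Hypothesis phi0_lebesgue : lebesgue_property phi0.
Hypothesis phi0_0 : phi0 0 = 0.
Variable Zhat : L1 P.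
Hypothesis Zhat_dominating : dominating phi0 Zhat.
Variable Q : probability T R.
Hypothesis Q_density : normalized_density Q Zhat.
Implicit Types (f g h : T -> R) (Z : L1 P) (c : R).
Let dom := dom_conjugate phi0.

(** The absolute values keep the integrand nonnegative at every point; they
    change nothing almost everywhere when [f >= 0] and [Z] is in the domain of
    the conjugate. *)
Definition weighted_integral Z f : \bar R := (\int[P]_w (`|f w| * `|Z w|)%:E)%E.

(** [rho f <= c], see [phihat_le], in a form free of extended subtraction. *)
Definition modular_le f c : Prop := forall Z, dom Z ->
  (weighted_integral Z f <= (c + fine (conjugate phi0 Z))%:E)%E.

Let L1_measurable Z : measurable_fun [set: T] (Z : T -> R).
Proof. exact: measurable_funP. Qed.

Let weighted_measurable Z f : measurable_fun [set: T] f ->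
  measurable_fun [set: T] (fun w => (`|f w| * `|Z w|)%:E).
Proof.
move=> mf; apply/measurable_EFinP/measurable_funM; exact: measurableT_comp.
Qed.

Let weighted_ge0 Z f w : (0 <= (`|f w| * `|Z w|)%:E)%E.
Proof. by rewrite lee_fin mulr_ge0. Qed.

(** [Z dP] is absolutely continuous with respect to [Q]. *)
Lemma ae_dominated Z (p : T -> Prop) : dom Z -> (\forall w \ae Q, p w) ->
  \forall w \ae P, Z w != 0 -> p w.
Proof.
move=> dZ [N [mN QN0 pN]].
have mI : measurable_fun [set: T] (\1_N : T -> R) by exact: measurable_indic.
pose F : {mfun T >-> R} := mfun_Sub (mem_set mI).
have F0 : \forall w \ae Q, (L0cls P F) w = (0 : L0 P) w.
  have NC : \forall w \ae Q, ~ N w by exists N; split=> // w /=; rewrite notK.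
  have FE := normalized_density_ae Q_density (L0clsE P F).
  have zE := normalized_density_ae Q_density (L0_0 P).
  near=> w; rewrite (near FE w)// (near zE w)//= indicE memNset//.
  exact: (near NC w).
have FZ := dominating_ae Zhat_dominating Q_density dZ F0.
near=> w; move=> Zw; apply: contrapT => npw.
have Nw : N w by exact: pN.
have : (L0cls P F) w * Z w = (0 : L0 P) w * Z w by exact: (near FZ w).
rewrite (near (L0clsE P F) w)// (near (L0_0 P) w)//= indicE mem_set//.
by rewrite mul1r mul0r; apply/eqP.
Unshelve. all: by end_near. Qed.

Lemma le_weighted_integral Z f g : dom Z -> measurable_fun [set: T] f ->
  measurable_fun [set: T] g -> (\forall w \ae Q, `|f w| <= `|g w|) ->
  (weighted_integral Z f <= weighted_integral Z g)%E.
Proof.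
move=> dZ mf mg fg; apply: ae_ge0_le_integral => //; try exact: weighted_measurable.
apply: filterS (ae_dominated dZ fg) => w fgw _; rewrite lee_fin.
by have [->|/fgw Zw] := eqVneq (Z w) 0; [rewrite normr0 !mulr0|rewrite ler_wpM2r].
Qed.

Lemma modular_le_mono f g c c' : measurable_fun [set: T] f ->
  measurable_fun [set: T] g -> (\forall w \ae Q, `|f w| <= `|g w|) -> c <= c' ->
  modular_le g c -> modular_le f c'.
Proof.
move=> mf mg fg cc gc Z dZ.
apply: le_trans (le_weighted_integral dZ mf mg fg) (le_trans (gc Z dZ) _).
by rewrite lee_fin lerD2r.
Qed.

Lemma modular_le_convex r f g h c c' : 0 <= r <= 1 ->
  measurable_fun [set: T] f -> measurable_fun [set: T] g ->
  measurable_fun [set: T] h ->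
  (\forall w \ae Q, `|h w| <= r * `|f w| + (1 - r) * `|g w|) ->
  modular_le f c -> modular_le g c' -> modular_le h (r * c + (1 - r) * c').
Proof.
move=> /andP[r0 r1] mf mg mh hfg fc gc Z dZ.
pose k w := r * `|f w| + (1 - r) * `|g w|.
have s0 : 0 <= 1 - r by rewrite subr_ge0.
have mk : measurable_fun [set: T] k.
  by apply: measurable_funD; apply: measurable_funM => //; exact: measurableT_comp.
apply: le_trans (@le_weighted_integral Z h k dZ mh mk _) _.
  by apply: filterS hfg => w; rewrite [`|k w|]ger0_norm// /k addr_ge0// mulr_ge0.
rewrite /weighted_integral.
under eq_integral.
  move=> w _; rewrite [`|k w|]ger0_norm; last by rewrite /k addr_ge0// mulr_ge0.
  rewrite mulrDl -!mulrA EFinD !EFinM; over.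
rewrite ge0_integralD//; first last.
- by apply: measurable_funeM; exact: weighted_measurable.
- by move=> w _; rewrite mule_ge0// ?lee_fin// mulr_ge0.
- by apply: measurable_funeM; exact: weighted_measurable.
- by move=> w _; rewrite mule_ge0// ?lee_fin// mulr_ge0.
rewrite !ge0_integralZl_EFin//; try exact: weighted_measurable.
have -> : r * c + (1 - r) * c' + fine (conjugate phi0 Z) =
  r * (c + fine (conjugate phi0 Z)) + (1 - r) * (c' + fine (conjugate phi0 Z)).
  by ring.
rewrite [leRHS]EFinD [in leRHS](EFinM r) [in leRHS](EFinM (1 - r)).
by apply: leeD; apply: lee_wpmul2l; rewrite ?lee_fin//; [exact: fc|exact: gc].
Qed.

Lemma modular_le0 c : 0 <= c -> modular_le (fun=> 0) c.
Proof.
move=> c0 Z dZ; rewrite /weighted_integral integral0_eq; last first.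
  by move=> w _; rewrite normr0 mul0r.
by rewrite lee_fin addr_ge0// fine_ge0// conjugate_ge0.
Qed.

(** The density of a linear minorant of [phi0] has a null conjugate, and it
    already bounds the modular from below by [0]. *)
Lemma modular_le_ge0 f c : modular_le f c -> 0 <= c.
Proof.
move=> fc; have [Z Z0] := exists_conjugate_le0 phi0_convex phi0_lebesgue phi0_0.
have cZ : conjugate phi0 Z = 0%E.
  by apply/eqP; rewrite eq_le Z0 conjugate_ge0.
have dZ : dom Z by rewrite /dom /dom_conjugate/= cZ.
have := fc Z dZ; rewrite cZ addr0; rewrite -lee_fin; apply: le_trans.
by apply: integral_ge0 => w _.
Qed.

(** Fatou's lemma under each [Z dP]. *)
Lemma modular_le_lim (f : nat -> T -> R) g c :
  (forall n, measurable_fun [set: T] (f n)) -> measurable_fun [set: T] g ->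
  (\forall w \ae Q, f n w @[n --> \oo] --> g w) ->
  (forall n, modular_le (f n) c) -> modular_le g c.
Proof.
move=> mf mg fg fc Z dZ.
pose F n w := (`|f n w| * `|Z w|)%:E.
have gF : \forall w \ae P, (`|g w| * `|Z w|)%:E = limn_einf (F ^~ w).
  apply: filterS (ae_dominated dZ fg) => w fgw; apply/esym.
  have FgZ : F n w @[n --> \oo] --> (`|g w| * `|Z w|)%:E.
    apply: cvg_EFin; first exact: nearW.
    have [Z0|/fgw fgw'] := eqVneq (Z w) 0.
      rewrite /= Z0 normr0 mulr0; apply: cvg_near_cst; apply: nearW => n.
      by rewrite /F/= Z0 normr0 mulr0.
    by apply: cvgMr_tmp; exact: cvg_norm.
  by rewrite is_cvg_limn_einfE; [exact/cvg_lim|apply/cvg_ex; eexists; exact: FgZ].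
rewrite /weighted_integral (ae_eq_integral (fun w => limn_einf (F ^~ w)))//.
- apply: le_trans (fatou _ measurableT _ _) _ => //.
    by move=> n; exact: weighted_measurable.
  by move=> n w _; exact: weighted_ge0.
  rewrite limn_einf_lim; apply: lime_le; first exact: is_cvg_einfs.
  apply: nearW => n; apply: le_trans (fc n Z dZ).
  by apply: ereal_inf_lbound; exists n => /=.
- exact: weighted_measurable.
- rewrite (_ : (fun _ => _) = (fun w => - limn_esup (-%E \o F ^~ w))%E).
    apply: measurableT_comp => //; apply: measurable_fun_limn_esup => n.
    by apply: measurableT_comp => //; exact: weighted_measurable.
  by apply/funext => w; rewrite limn_esupN oppeK.
- by apply: filterS gF.
Qed.

(** Fenchel-Young bounds the modular by [phi0] on bounded functions, and the
    Lebesgue property makes that bound small. *)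
Lemma modular_le_bounded_cvg0 (f : nat -> T -> R) (M e : R) :
  (forall n, measurable_fun [set: T] (f n)) -> (forall n w, `|f n w| <= M) ->
  (\forall w \ae Q, f n w @[n --> \oo] --> 0) -> 0 < e ->
  \forall n \near \oo, modular_le (f n) e.
Proof.
move=> mf fM [N [mN QN0 f0]] e0.
pose g n w := `|f n w| * \1_(~` N) w.
have mCN : measurable (~` N) by exact: measurableC.
have mg n : measurable_fun [set: T] (g n).
  apply: measurable_funM; first exact: measurableT_comp.
  exact: measurable_indic.
have g_ge0 n w : 0 <= g n w by rewrite /g indicE mulr_ge0.
have gM n w : `|g n w| <= M.
  rewrite ger0_norm// /g indicE; case: (_ \in _); rewrite ?mulr1// mulr0.
  exact: le_trans (fM n w).
have g0 w : g n w @[n --> \oo] --> 0.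
  have [Nw|Nw] := pselect (N w).
    by apply: cvg_near_cst; apply: nearW => n; rewrite /g indicE memNset ?mulr0//; exact.
  have gf : (fun n => g n w) = (fun n => `|f n w|).
    by apply/funext => n; rewrite /g indicE mem_set ?mulr1.
  rewrite gf -[X in _ --> X](@normr0 _ R); apply: cvg_norm.
  by apply: contrapT => nf; apply: Nw; exact: f0.
have bg n : bounded_measurable (g n) by split=> //; exists M.
have := lebesgue_cvg phi0_lebesgue mg gM g0.
rewrite Linfty_class0 phi0_0 => /cvgrPdist_le/(_ _ e0).
apply: filterS => n; rewrite sub0r normrN => phi_le Z dZ.
have NC : \forall w \ae Q, ~ N w by exists N; split=> // w /=; rewrite notK.
have gZ : weighted_integral Z (f n) = (\int[P]_w (g n w * Z w)%:E)%E.
  apply: ae_eq_integral => //; first exact: weighted_measurable.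
    by apply/measurable_EFinP/measurable_funM.
  apply: filterS2 (ae_dominated dZ NC) (dom_conjugate_ge0 phi0_convex phi0_0 dZ).
  move=> w NCw Z0 _; rewrite (ger0_norm Z0); congr (_ %:E).
  have [->|/NCw NCw'] := eqVneq (Z w) 0; first by rewrite !mulr0.
  by rewrite /g indicE mem_set// mulr1.
rewrite gZ; apply: le_trans (fenchel_young phi0 Z (bg n)) _.
rewrite (conjugate_fin phi0_0 dZ) -EFinD lee_fin lerD2r.
exact: le_trans (ler_norm _) phi_le.
Qed.

Lemma phihat_le (X : L0 P) f c : measurable_fun [set: T] f ->
  (\forall w \ae Q, X w = `|f w|) -> (phihat phi0 X <= c%:E)%E <-> modular_le f c.
Proof.
move=> mf Xf.
have E Z : dom Z -> ('E_P[(X : T -> R) \* Z])%E = weighted_integral Z f.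
  move=> dZ; rewrite unlock; apply: ae_eq_integral => //.
  - by apply/measurable_EFinP/measurable_funM; exact: measurable_funP.
  - exact: weighted_measurable.
  - apply: filterS2 (ae_dominated dZ Xf) (dom_conjugate_ge0 phi0_convex phi0_0 dZ).
    move=> w Xfw Z0 _ /=; rewrite (ger0_norm Z0).
    by have [->|/Xfw ->] := eqVneq (Z w) 0; rewrite ?mulr0.
have leE Z : dom Z -> ('E_P[(X : T -> R) \* Z] - conjugate phi0 Z <= c%:E)%E =
    (weighted_integral Z f <= (c + fine (conjugate phi0 Z))%:E)%E.
  move=> dZ; rewrite E// (conjugate_fin phi0_0 dZ) leeBlDr//.
split=> [Xc Z dZ|fc].
  by rewrite -leE//; apply: le_trans Xc; apply: ereal_sup_ubound; exists Z.
by apply: ge_ereal_sup => _ [Z dZ <-]; rewrite leE//; exact: fc.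
Qed.

Lemma Zhat_neq0 : \forall w \ae Q, Zhat w != 0.
Proof.
have mZ0 : measurable [set w | Zhat w = 0].
  rewrite (_ : mkset _ = [set: T] `&` (Zhat : T -> R) @^-1` [set 0]).
    by apply: L1_measurable => //; exact: measurable_set1.
  by rewrite setTI.
exists [set w | Zhat w = 0]; split=> //; last first.
  by move=> w /= /negP; rewrite negbK => /eqP.
rewrite Q_density.2//; apply: integral0_eq => w /= ->.
by rewrite mul0r.
Qed.

Lemma ae_Zhat (p : T -> Prop) : (\forall w \ae P, Zhat w != 0 -> p w) ->
  \forall w \ae Q, p w.
Proof.
move=> /(normalized_density_ae Q_density).
by apply: filterS2 Zhat_neq0 => w Zw; exact.
Qed.

Lemma weighted_Zhat_le f c : modular_le f c ->
  (weighted_integral Zhat f <= (c + 1)%:E)%E.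
Proof.
have [dZ Z1 _] := Zhat_dominating.
move=> /(_ _ dZ)/le_trans; apply; rewrite lee_fin lerD2l.
by rewrite -lee_fin -(conjugate_fin phi0_0 dZ).
Qed.

Lemma weighted_Zhat_eq0 f : measurable_fun [set: T] f ->
  weighted_integral Zhat f = 0%E -> \forall w \ae Q, f w = 0.
Proof.
move=> mf f0; apply: ae_Zhat.
have : ae_eq P [set: T] (fun w => (`|f w| * `|Zhat w|)%:E) (cst 0%E).
  apply/ae_eq_integral_abs => //; first exact: weighted_measurable.
  by under eq_integral do rewrite gee0_abs//.
apply: filterS => w /= /(_ I)[/eqP]; rewrite mulf_eq0 !normr_eq0.
by move=> /orP[/eqP//|/eqP ->]; rewrite eqxx.
Qed.

Lemma weighted_Zhat_scale r f : measurable_fun [set: T] f ->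
  weighted_integral Zhat (fun w => r * f w) =
  (`|r|%:E * weighted_integral Zhat f)%E.
Proof.
move=> mf; rewrite /weighted_integral -ge0_integralZl_EFin//; last first.
  exact: weighted_measurable.
by apply: eq_integral => w _; rewrite normrM -mulrA.
Qed.

(** Integrating the series against [Zhat dP] shows that it converges
    absolutely almost everywhere where [Zhat] does not vanish. *)
Lemma ae_summable (v : nat -> T -> R) (C : R) : 0 <= C ->
  (forall n, measurable_fun [set: T] (v n)) ->
  (forall n, (weighted_integral Zhat (v n) <= (C / (2 ^ n.+1)%:R)%:E)%E) ->
  \forall w \ae Q, cvgn (series (v ^~ w)).
Proof.
move=> C0 mv vC; apply: ae_Zhat.
pose F w : \bar R := (\sum_(0 <= n <oo) (`|v n w| * `|Zhat w|)%:E)%E.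
have mF : measurable_fun [set: T] F.
  by apply: ge0_emeasurable_sum => // n _ _; exact: weighted_measurable.
have F_ge0 w : (0 <= F w)%E by apply: nneseries_ge0.
have iF : (\int[P]_w F w < +oo)%E.
  rewrite integral_nneseries//; last by move=> n; exact: weighted_measurable.
  apply: le_lt_trans (ltry C); apply: le_trans (epsilon_trick0 xpredT C0).
  apply: lee_nneseries => [n _ _|n _]; last exact: vC.
  exact: integral_ge0.
have iF' : P.-integrable [set: T] F.
  apply/integrableP; split=> //.
  by under eq_integral do rewrite gee0_abs//.
apply: filterS (integrable_ae measurableT iF') => w /(_ I) Fw Zw.
apply: normed_cvg; apply: nondecreasing_is_cvgn.
  by apply: nondecreasing_series => n _ _; exact: normr_ge0.
exists (fine (F w) / `|Zhat w|) => _ [n _ <-].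
rewrite ler_pdivlMr ?normr_gt0// -lee_fin fineK// /series/= mulr_suml.
by rewrite -sumEFin; apply: nneseries_lim_ge => k _ _.
Qed.

(** * The heart and its Luxemburg norm *)

(** The defining condition of [Mu]: as tails decrease, the existence of one
    level is the same as the limit along all levels, see [Mu_heart]. *)
Definition heart f : Prop := forall a e : R, 0 < a -> 0 < e ->
  exists n : nat, modular_le (fun w => a * truncate_below n%:R (f w)) e.

Let measurable_tail a r f : measurable_fun [set: T] f ->
  measurable_fun [set: T] (fun w => a * truncate_below r (f w)).
Proof.
move=> mf; apply: measurable_funM => //.
by apply: (measurableT_comp (measurable_truncate_below r)).
Qed.

Lemma truncate_below_ge0 (r x : R) : 0 <= truncate_below r x.
Proof. by rewrite /truncate_below; case: ifP. Qed.

Lemma truncate_below_mono (r s x y : R) : r <= s -> `|x| <= `|y| ->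
  truncate_below s x <= truncate_below r y.
Proof.
move=> rs xy; rewrite /truncate_below; case: ifPn => [sx|_]; last by case: ifP.
by rewrite ifT//; apply: le_lt_trans rs (lt_le_trans sx xy).
Qed.

(** If [|z| <= B |x| + |y|] is large, then the larger of the two summands is
    large too and accounts for at least half of it. *)
Lemma truncate_below_add (B r s K x y z : R) : 0 <= B -> 0 <= r -> 0 <= s ->
  2 * (B * r + s) <= K -> `|z| <= B * `|x| + `|y| ->
  truncate_below K z <= 2 * B * truncate_below r x + 2 * truncate_below s y.
Proof.
move=> B0 r0 s0 rsK zxy; have := mulr_ge0 B0 r0; have := mulr_ge0 B0 (normr_ge0 x).
have := normr_ge0 y; have := normr_ge0 z.
rewrite /truncate_below; case: ltP => Kz; last first.
  by move=> *; apply: addr_ge0; apply: mulr_ge0; rewrite ?mulr_ge0//; case: ifP.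
case: ltP => rx; case: ltP => sy; try lra.
- by have := ler_wpM2l B0 rx; lra.
- by have := ler_wpM2l B0 rx; lra.
Qed.

(** Splitting [f n] at the level [K] where the tail of [Y] is small. *)
Lemma heart_dominated_cvg0 (f : nat -> T -> R) Y (e : R) :
  (forall n, measurable_fun [set: T] (f n)) -> measurable_fun [set: T] Y ->
  heart Y -> (forall n, \forall w \ae Q, `|f n w| <= `|Y w|) ->
  (\forall w \ae Q, f n w @[n --> \oo] --> 0) -> 0 < e ->
  \forall n \near \oo, modular_le (f n) e.
Proof.
move=> mf mY hY fY f0 e0.
have [K YK] := hY 2 e (ltr0Sn _ _) e0.
pose g n w := 2 * Num.min `|f n w| K%:R.
have mg n : measurable_fun [set: T] (g n).
  apply: measurable_funM => //; apply: measurable_minr => //.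
  exact: measurableT_comp.
have g_ge0 n w : 0 <= g n w by rewrite /g mulr_ge0// le_min normr_ge0 ler0n.
have gM n w : `|g n w| <= 2 * K%:R.
  by rewrite ger0_norm// ler_wpM2l// ge_min lexx orbT.
have g0 : \forall w \ae Q, g n w @[n --> \oo] --> 0.
  apply: filterS f0 => w fw; apply: (@squeeze_cvgr _ _ _ _ (cst 0) (fun n => 2 * `|f n w|)).
  - apply: nearW => n; rewrite g_ge0/= /g ler_wpM2l//.
    by rewrite ge_min lexx.
  - exact: cvg_cst.
  - by rewrite -(mulr0 2) -(@normr0 _ R); apply: cvgMl_tmp; exact: cvg_norm.
apply: filterS (modular_le_bounded_cvg0 mg gM g0 e0) => n ge.
have -> : e = 2^-1 * e + (1 - 2^-1) * e by lra.
apply: (modular_le_convex _ (mg n) (measurable_tail _ _ mY) (mf n) _ ge YK).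
  by lra.
apply: filterS (fY n) => w fYw; rewrite (ger0_norm (g_ge0 n w)) normrM.
rewrite (ger0_norm (truncate_below_ge0 _ _)) ger0_norm//.
have := truncate_below_ge0 K%:R (Y w); rewrite /g.
have [fK|Kf] := leP `|f n w| K%:R; first lra.
rewrite /truncate_below ifT; first by have := ler0n R K; lra.
exact: lt_le_trans Kf fYw.
Qed.

Lemma heart_cst0 : heart (fun=> 0).
Proof.
move=> a e a0 e0; exists 0.
have -> : (fun=> a * truncate_below 0%:R 0) = (fun=> 0) :> (T -> R).
  by apply/funext => w; rewrite /truncate_below normr0; case: ifP; rewrite mulr0.
by apply: modular_le0; exact: ltW.
Qed.

Lemma heart_add (A : R) f g h : 0 <= A -> measurable_fun [set: T] f ->
  measurable_fun [set: T] g -> measurable_fun [set: T] h ->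
  (\forall w \ae Q, `|h w| <= A * `|f w| + `|g w|) ->
  heart f -> heart g -> heart h.
Proof.
move=> A0 mf mg mh hfg hf hg a e a0 e0; pose B := A + 1.
have B0 : 0 < B by rewrite /B; lra.
have [n fn] := hf (4 * a * B) e (ltac:(by rewrite !mulr_gt0)) e0.
have [m gm] := hg (4 * a) e (ltac:(by rewrite !mulr_gt0)) e0.
pose K := (Num.truncn (2 * (B * n%:R + m%:R))).+1; exists K.
have KE : 2 * (B * n%:R + m%:R) <= K%:R by exact/ltW/truncnS_gt.
have -> : e = 2^-1 * e + (1 - 2^-1) * e by lra.
apply: (modular_le_convex _ (measurable_tail _ _ mf) (measurable_tail _ _ mg)
  (measurable_tail _ _ mh) _ fn gm); first by lra.
apply: filterS hfg => w hw.
have [a0' B0'] := (ltW a0, ltW B0).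
rewrite !ger0_norm ?mulr_ge0 ?truncate_below_ge0//.
have hB : `|h w| <= B * `|f w| + `|g w|.
  by apply: le_trans hw _; rewrite lerD2r ler_wpM2r// lerDl.
have := truncate_below_add (ltW B0) (ler0n R n) (ler0n R m) KE hB.
by move=> /(ler_wpM2l (ltW a0)); lra.
Qed.

Definition luxemburg_norm f : \bar R := ereal_inf [set l%:E | l in
  [set l : R | 0 < l /\ modular_le (fun w => l^-1 * f w) 1]].

Lemma luxemburg_norm_ge0 f : (0 <= luxemburg_norm f)%E.
Proof. by apply: le_ereal_inf_tmp => _ [l [l0 _] <-]; rewrite lee_fin ltW. Qed.

Lemma luxemburg_norm_le f (l : R) : 0 < l ->
  modular_le (fun w => l^-1 * f w) 1 -> (luxemburg_norm f <= l%:E)%E.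
Proof. by move=> l0 fl; apply: ereal_inf_lbound; exists l. Qed.

Let measurable_scale a f : measurable_fun [set: T] f ->
  measurable_fun [set: T] (fun w => a * f w).
Proof. by move=> mf; apply: measurable_funM. Qed.

Lemma luxemburg_norm_lt f (l : R) : measurable_fun [set: T] f ->
  (luxemburg_norm f < l%:E)%E -> 0 < l /\ modular_le (fun w => l^-1 * f w) 1.
Proof.
move=> mf /ereal_inf_lt[_ [k [k0 fk] <-]]; rewrite lte_fin => kl.
have l0 := lt_trans k0 kl; split=> //.
apply: (modular_le_mono _ _ _ (lexx 1) fk); try exact: measurable_scale.
apply: nearW => w; rewrite !normrM ler_wpM2r//.
by rewrite !gtr0_norm ?invr_gt0// lef_pV2 ?posrE// ltW.
Qed.

Lemma heart_luxemburg_norm_fin f : measurable_fun [set: T] f -> heart f ->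
  (luxemburg_norm f < +oo)%E.
Proof.
move=> mf hf.
have [|||n _ /(_ n (leqnn _)) fn] := @heart_dominated_cvg0
  (fun n w => n.+1%:R^-1 * f w) f 1 _ mf hf _ _ ltr01.
- by move=> n; exact: measurable_scale.
- move=> n; apply: nearW => w; rewrite normrM ler_piMl//.
  by rewrite ger0_norm// invf_le1// ler1n.
- apply: nearW => w; rewrite -(mul0r (f w)); apply: cvgMr_tmp.
  exact: cvg_harmonic.
by apply: le_lt_trans (luxemburg_norm_le _ fn) (ltry _).
Qed.

Lemma luxemburg_norm_mono f g : measurable_fun [set: T] f ->
  measurable_fun [set: T] g -> (\forall w \ae Q, `|f w| <= `|g w|) ->
  (luxemburg_norm f <= luxemburg_norm g)%E.
Proof.
move=> mf mg fg; apply: le_ereal_inf_tmp => _ [l [l0 gl] <-].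
apply: luxemburg_norm_le => //.
apply: (modular_le_mono _ _ _ (lexx 1) gl); try exact: measurable_scale.
by apply: filterS fg => w fgw; rewrite !normrM ler_wpM2l.
Qed.

(** The bound [\int |f| Zhat dP <= 2 l] holds for every [l > 0]. *)
Lemma luxemburg_norm_eq0 f : measurable_fun [set: T] f ->
  luxemburg_norm f = 0%E -> \forall w \ae Q, f w = 0.
Proof.
move=> mf f0; apply: weighted_Zhat_eq0 => //.
apply/eqP; rewrite eq_le integral_ge0// andbT.
apply/lee_addgt0Pr => e e0; rewrite add0e.
have e20 : 0 < e / 2 by rewrite divr_gt0.
have [|_ /weighted_Zhat_le] := @luxemburg_norm_lt f (e / 2) mf.
  by rewrite f0 lte_fin.
rewrite weighted_Zhat_scale// gtr0_norm ?invr_gt0// lee_pdivrMl//.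
by rewrite -EFinM (_ : e / 2 * (1 + 1) = e)//; lra.
Qed.

Lemma luxemburg_norm_cst0 : luxemburg_norm (fun=> 0) = 0%E.
Proof.
apply/eqP; rewrite eq_le luxemburg_norm_ge0 andbT.
apply/lee_addgt0Pr => e e0; rewrite add0e; apply: luxemburg_norm_le => //.
by under eq_fun do rewrite mulr0; apply: modular_le0.
Qed.

Let luxemburg_norm_scale_le (a : R) f : a != 0 -> measurable_fun [set: T] f ->
  (luxemburg_norm (fun w => a * f w)%R <= `|a|%:E * luxemburg_norm f)%E.
Proof.
move=> a0 mf; have na0 : 0 < `|a| by rewrite normr_gt0.
rewrite -lee_pdivrMl//; apply: le_ereal_inf_tmp => _ [l [l0 fl] <-].
rewrite lee_pdivrMl// -EFinM; apply: luxemburg_norm_le; first exact: mulr_gt0.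
apply: (modular_le_mono _ _ _ (lexx 1) fl).
- by do 2 apply: measurable_scale.
- exact: measurable_scale.
apply: nearW => w; rewrite !normrM invfM !normrM !normfV normr_id.
by rewrite mulrACA mulVf ?normr_eq0// mul1r.
Qed.

Lemma luxemburg_norm_scale (a : R) f : measurable_fun [set: T] f ->
  (luxemburg_norm f < +oo)%E ->
  luxemburg_norm (fun w => a * f w) = (`|a|%:E * luxemburg_norm f)%E.
Proof.
move=> mf ffin; have [->|a0] := eqVneq a 0.
  rewrite normr0 mul0e -luxemburg_norm_cst0; congr luxemburg_norm.
  by apply/funext => w; rewrite mul0r.
apply/eqP; rewrite eq_le luxemburg_norm_scale_le//=.
have na0 : 0 < `|a| by rewrite normr_gt0.
have := @luxemburg_norm_scale_le a^-1 _ _ (measurable_scale a mf).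
rewrite invr_eq0 => /(_ a0).
under eq_fun do rewrite mulKf//.
by rewrite normfV => /(lee_wpmul2l (_ : 0 <= `|a|%:E)%E)/wrap[//|]; rewrite muleA -EFinM divff ?mul1e// normr_eq0.
Qed.

(** The unit ball [{modular <= 1}] is convex. *)
Lemma luxemburg_norm_triangle f g h : measurable_fun [set: T] f ->
  measurable_fun [set: T] g -> measurable_fun [set: T] h ->
  (\forall w \ae Q, `|h w| <= `|f w| + `|g w|) ->
  (luxemburg_norm f < +oo)%E -> (luxemburg_norm g < +oo)%E ->
  (luxemburg_norm h <= luxemburg_norm f + luxemburg_norm g)%E.
Proof.
move=> mf mg mh hfg ffin gfin.
have fE : luxemburg_norm f \is a fin_num by rewrite ge0_fin_numE// luxemburg_norm_ge0.
have gE : luxemburg_norm g \is a fin_num by rewrite ge0_fin_numE// luxemburg_norm_ge0.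
apply/lee_addgt0Pr => e e0.
pose l := fine (luxemburg_norm f) + e / 2; pose m := fine (luxemburg_norm g) + e / 2.
have [|l0 fl] := @luxemburg_norm_lt f l mf.
  by rewrite -[ltLHS]fineK// lte_fin /l ltrDl divr_gt0.
have [|m0 gm] := @luxemburg_norm_lt g m mg.
  by rewrite -[ltLHS]fineK// lte_fin /m ltrDl divr_gt0.
have -> : (luxemburg_norm f + luxemburg_norm g + e%:E = (l + m)%:E)%E.
  rewrite -[luxemburg_norm f]fineK// -[luxemburg_norm g]fineK// -!EFinD.
  by congr EFin; rewrite /l /m; lra.
have lm0 : 0 < l + m by rewrite addr_gt0.
apply: luxemburg_norm_le => //.
pose r := l / (l + m).
have r01 : 0 <= r <= 1.
  by rewrite /r ler_pdivrMr// mul1r lerDl (ltW m0) divr_ge0// ltW.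
have sE : 1 - r = m / (l + m) by rewrite /r; field; rewrite gt_eqF.
rewrite (_ : 1 = r * 1 + (1 - r) * 1); last by lra.
apply: (modular_le_convex r01 (measurable_scale _ mf) (measurable_scale _ mg)
  (measurable_scale _ mh) _ fl gm).
have lE x : l / (l + m) * (l^-1 * x) = (l + m)^-1 * x by field; rewrite !gt_eqF.
have mE x : m / (l + m) * (m^-1 * x) = (l + m)^-1 * x by field; rewrite !gt_eqF.
have absV x : 0 < x -> `|x^-1| = x^-1 by move=> x0; rewrite gtr0_norm ?invr_gt0.
apply: filterS hfg => w hw; rewrite sE /r !normrM !absV// lE mE -mulrDr.
by rewrite ler_wpM2l// invr_ge0 ltW.
Qed.

(** [|g| 1_{|g| > k}] splits into a norm-small part and [|u n| 1_{|g| > k}],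
    which is dominated by [|u n|] and vanishes as [k] grows. *)
Lemma heart_limit (u : nat -> T -> R) g : (forall n, measurable_fun [set: T] (u n)) ->
  measurable_fun [set: T] g -> (forall n, heart (u n)) ->
  (forall e : R, 0 < e -> exists n, modular_le (fun w => e^-1 * (u n w - g w)) 1) ->
  heart g.
Proof.
move=> mu mg hu ug a e a0 e0.
(* Chosen so that [2 a l] is at most [1], hence a convex weight, and at most
   [e]. *)
pose l := Num.min 1 e / (2 * a).
have me0 : 0 < Num.min 1 e by rewrite lt_min ltr01 e0.
have l0 : 0 < l by rewrite divr_gt0// mulr_gt0.
have [n un] := ug l l0.
have mug : measurable_fun [set: T] (fun w => u n w - g w) by exact: measurable_funB.
have alE : 2 * a * l = Num.min 1 e by rewrite /l; field; rewrite gt_eqF.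
have diff_le : modular_le (fun w => 2 * a * (u n w - g w)) e.
  have r01 : 0 <= 2 * a * l <= 1 by rewrite alE ltW//= ge_min lexx.
  have := modular_le_convex r01 (measurable_scale _ mug) (measurable_cst (0 : R))
    (measurable_scale (2 * a) mug) _ un (modular_le0 (lexx 0)).
  move=> /(_ _)/wrap[|H].
    apply: nearW => w; rewrite normr0 mulr0 addr0 !normrM.
    rewrite (gtr0_norm (x := l^-1)) ?invr_gt0// (gtr0_norm a0) ger0_norm//.
    by rewrite mulrA -(mulrA _ l) divff ?gt_eqF// mulr1.
  apply: (modular_le_mono _ _ _ _ H); try exact: measurable_scale.
    exact: nearW.
  by rewrite mulr0 addr0 mulr1 alE ge_min lexx orbT.
pose f k w := if k%:R < `|g w| then 2 * a * u n w else 0.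
have mf k : measurable_fun [set: T] (f k).
  apply: measurable_fun_ifT => //; last exact: measurable_scale.
  by apply: measurable_fun_ltr => //; exact: measurableT_comp.
have hY : heart (fun w => 2 * a * u n w).
  apply: (@heart_add (2 * a) (u n) (fun=> 0)) => //.
  - by rewrite mulr_ge0// ltW.
  - exact: measurable_scale.
  - by apply: nearW => w; rewrite normr0 addr0 !normrM (gtr0_norm a0) ger0_norm.
  - exact: heart_cst0.
have [||k _ /(_ k (leqnn _)) fk] :=
    @heart_dominated_cvg0 f _ e mf (measurable_scale _ (mu n)) hY _ _ e0.
- move=> k; apply: nearW => w; rewrite /f; case: ifP => // _.
  by rewrite normr0.
- apply: nearW => w; apply: cvg_near_cst; near=> k.
  rewrite /f ifF//; apply/negbTE; rewrite -leNgt.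
  by near: k; exact: nbhs_infty_ger.
exists k; have -> : e = 2^-1 * e + (1 - 2^-1) * e by lra.
apply: (modular_le_convex _ (measurable_scale _ mug) (mf k)
  (measurable_tail _ _ mg) _ diff_le fk); first by lra.
apply: nearW => w; rewrite /f /truncate_below; case: ifPn => _; last first.
  by rewrite mulr0 normr0 mulr0 addr0 mulr_ge0.
rewrite !normrM normr_id (gtr0_norm a0) (gtr0_norm (x := 2))//.
have := ler_wpM2l (ltW a0) (ler_normB (u n w) (u n w - g w)).
rewrite opprB addrC subrK; lra.
Unshelve. all: by end_near. Qed.

(** Along a rapidly Cauchy subsequence [u (s k)], the increments are summable
    almost everywhere, whence a pointwise limit; Fatou's lemma makes it the
    limit in norm of the whole sequence. *)
Lemma luxemburg_norm_complete (u : nat -> T -> R) :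
  (forall n, measurable_fun [set: T] (u n)) -> (forall n, heart (u n)) ->
  (forall e : R, 0 < e -> exists n0, forall m n, (n0 <= m)%N -> (n0 <= n)%N ->
    (luxemburg_norm (fun w => u m w - u n w)%R < e%:E)%E) ->
  exists g, [/\ measurable_fun [set: T] g, heart g & forall e : R, 0 < e ->
    \forall n \near \oo, (luxemburg_norm (fun w => u n w - g w)%R <= e%:E)%E].
Proof.
move=> mu hu cu.
have muB m n : measurable_fun [set: T] (fun w => u m w - u n w).
  exact: measurable_funB.
have {}cu (e : R) : 0 < e -> exists n0, forall m n, (n0 <= m)%N -> (n0 <= n)%N ->
    modular_le (fun w => e^-1 * (u m w - u n w)) 1.
  move=> /cu[n0 Hn0]; exists n0 => m n m0 n0'.
  by have [] := luxemburg_norm_lt (muB m n) (Hn0 m n m0 n0').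
have half_gt0 k : 0 < (2^-1 : R) ^+ k by rewrite exprn_gt0// invr_gt0.
have [N HN] := choice (fun k => cu _ (half_gt0 k)).
(* A nondecreasing sequence of indices with [N k <= s k] and [k <= s k]. *)
pose s k := (\sum_(i < k.+1) (N i).+1)%N.
have sN k : (N k <= s k)%N.
  by rewrite /s big_ord_recr/= (leq_trans (leqnSn _))// leq_addl.
have sS k : (s k <= s k.+1)%N by rewrite /s [leqRHS]big_ord_recr leq_addr.
have s_ge k : (k <= s k)%N.
  elim: k => // k IH; rewrite /s big_ord_recr/= -/(s k) addnS ltnS.
  by rewrite (leq_trans IH)// leq_addr.
pose v k w := u (s k.+1) w - u (s k) w.
have v_cvg : \forall w \ae Q, cvgn (series (v ^~ w)).
  (* The modular bound [1] costs [2] under [Zhat], and [2 / 2^k = 4 / 2^(k+1)]. *)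
  apply: (@ae_summable v 4) => // k; first exact: muB.
  have := weighted_Zhat_le (HN k _ _ (leq_trans (sN k) (sS k)) (sN k)).
  rewrite (weighted_Zhat_scale _ (muB _ _)) gtr0_norm ?invr_gt0// lee_pdivrMl//.
  rewrite -EFinM => /le_trans; apply; rewrite lee_fin natrX exprS exprVn.
  by rewrite invfM mulrA (mulrC _ (1 + 1)) -!mulrA; nra.
pose g w := fine (limn_esup (fun k => (u (s k) w)%:E)).
have mg : measurable_fun [set: T] g.
  apply: measurableT_comp => //; apply: measurable_fun_limn_esup => k.
  exact/measurable_EFinP.
have ug : \forall w \ae Q, u (s k) w @[k --> \oo] --> g w.
  apply: filterS v_cvg => w /cvg_ex[l /= vl].
  have ul : u (s k) w @[k --> \oo] --> u (s 0%N) w + l.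
    have -> : (fun k => u (s k) w) = (fun k => u (s 0%N) w + series (v ^~ w) k).
      apply/funext => k; rewrite /series/= telescope_sumr//.
      by rewrite addrC subrK.
    by apply: cvgD => //; exact: cvg_cst.
  have Eul : (u (s k) w)%:E @[k --> \oo] --> (u (s 0%N) w + l)%:E.
    by apply: cvg_EFin => //; exact: nearW.
  suff -> : g w = u (s 0%N) w + l by [].
  rewrite /g is_cvg_limn_esupE; first by rewrite (cvg_lim _ Eul).
  by apply/cvg_ex; eexists; exact: Eul.
have mgB n : measurable_fun [set: T] (fun w => u n w - g w).
  exact: measurable_funB.
have lim_le (e : R) : 0 < e -> exists n0, forall n, (n0 <= n)%N ->
    modular_le (fun w => e^-1 * (u n w - g w)) 1.
  move=> /cu[n0 Hn0]; exists n0 => n n0n.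
  apply: (@modular_le_lim (fun k w => e^-1 * (u n w - u (s (k + n0)%N) w))).
  - by move=> k; exact: measurable_scale.
  - exact: measurable_scale.
  - apply: filterS ug => w ugw; apply: cvgMl_tmp; apply: cvgB; first exact: cvg_cst.
    by have := ugw; rewrite -(cvg_shiftn n0).
  - move=> k; apply: Hn0 => //; apply: leq_trans (s_ge _); exact: leq_addl.
exists g; split=> //.
  apply: (heart_limit mu mg hu) => e e0; have [n0 Hn0] := lim_le e e0.
  by exists n0; exact: Hn0.
move=> e e0; have [n0 Hn0] := lim_le e e0.
near=> n; apply: luxemburg_norm_le => //; apply: Hn0.
by near: n; exact: nbhs_infty_ge.
Unshelve. all: by end_near. Qed.

(** * The space over [Q] *)

Lemma phihat_ge0 (X : L0 P) f : measurable_fun [set: T] f ->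
  (\forall w \ae Q, X w = `|f w|) -> (0 <= phihat phi0 X)%E.
Proof.
move=> mf Xf; case XE : (phihat phi0 X) => [c| //|].
  by rewrite lee_fin; apply: (@modular_le_ge0 f); apply/(phihat_le _ mf Xf); rewrite XE.
have /modular_le_ge0 : modular_le f (-1) by apply/(phihat_le _ mf Xf); rewrite XE leNye.
by rewrite oppr_ge0 ler10.
Qed.

Let L0_measurable (mu : probability T R) (X : L0 mu) :
  measurable_fun [set: T] (X : T -> R).
Proof. exact: measurable_funP. Qed.

Lemma Mu_heart (X : L0 P) : Mu phi0 X <-> heart X.
Proof.
have mX := L0_measurable X.
have mt a r := measurable_tail a r mX.
have tE (a r : R) : 0 < a -> \forall w \ae Q,
    (a *: tail r X : L0 P) w = `|a * truncate_below r (X w)|.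
  move=> a0; apply: (normalized_density_ae Q_density).
  have tX := L0clsE P (truncate_below r \o L0rep X : {mfun T >-> R}).
  near=> w; rewrite (near (L0Z a (tail r X)) w)// (near tX w)//=.
  by rewrite ger0_norm// mulr_ge0 ?truncate_below_ge0// ltW.
split=> [MX a e a0 e0|hX a a0].
  have /fine_cvgP[fin /cvgrPdist_le/(_ _ e0) near_e] := MX a a0.
  near \oo => n; exists n; apply/(phihat_le _ (mt _ _) (tE _ _ a0)).
  rewrite -[leLHS]fineK; last by near: n.
  rewrite lee_fin; apply: le_trans (ler_norm _) _.
  by rewrite -normrN -sub0r; near: n.
apply: cvge0_squeeze => [n|e e0].
  exact: phihat_ge0 (mt _ _) (tE _ _ a0).
have [n Xn] := hX a e a0 e0; near=> m.
apply/(phihat_le _ (mt _ _) (tE _ _ a0)).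
apply: (modular_le_mono (mt _ _) (mt _ _) _ (lexx _) Xn).
apply: nearW => w; rewrite !ger0_norm ?mulr_ge0 ?truncate_below_ge0 ?(ltW a0)//.
rewrite ler_wpM2l ?(ltW a0)// truncate_below_mono// ler_nat.
by near: m; exact: nbhs_infty_ge.
Unshelve. all: by end_near. Qed.

Lemma heart_ae_eq f g : measurable_fun [set: T] f -> measurable_fun [set: T] g ->
  (\forall w \ae Q, f w = g w) -> heart f -> heart g.
Proof.
move=> mf mg fg hf; apply: (@heart_add 1 f (fun=> 0)) => //; last exact: heart_cst0.
by apply: filterS fg => w ->; rewrite mul1r normr0 addr0.
Qed.

Lemma MuQ_heart (xi : L0 Q) : MuQ Q phi0 xi <-> heart xi.
Proof.
split=> [[X /Mu_heart hX <-]|hxi].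
  apply: heart_ae_eq hX; try exact: L0_measurable.
  by apply: filterS (L0clsE Q (L0rep X)) => w ->.
exists (L0cls P (L0rep xi)); last by rewrite (L0proj_cls _ Q_density) L0repK.
apply/Mu_heart; apply: heart_ae_eq hxi; try exact: L0_measurable.
apply: (normalized_density_ae Q_density).
by apply: filterS (L0clsE P (L0rep xi)) => w <-.
Qed.

Lemma luxemburgQE (xi : L0 Q) : luxemburgQ Q phi0 xi = luxemburg_norm xi.
Proof.
have lE (l : R) : 0 < l -> \forall w \ae Q,
    (l^-1 *: L0abs (L0cls P (L0rep xi)) : L0 P) w = `|l^-1 * xi w|.
  move=> l0; apply: (normalized_density_ae Q_density); pose X := L0cls P (L0rep xi).
  near=> w; rewrite (near (L0Z l^-1 (L0abs X)) w)// (near (L0absE X) w)//.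
  rewrite (near (L0clsE P (L0rep xi)) w)// normrM.
  by rewrite (gtr0_norm (x := l^-1)) ?invr_gt0.
have ml l := measurable_scale l (L0_measurable xi).
congr (ereal_inf (image _ _)); apply/seteqP; split=> l /= [l0].
  by move=> /(phihat_le _ (ml _) (lE _ l0)).
by move=> H; split=> //; apply/(phihat_le _ (ml _) (lE _ l0)).
Unshelve. all: by end_near. Qed.

Lemma luxemburgQ_banach_lattice :
  banach_lattice (MuQ Q phi0) (luxemburgQ Q phi0).
Proof.
have Mfin (X : L0 Q) : MuQ Q phi0 X -> (luxemburg_norm X < +oo)%E.
  by move=> /MuQ_heart; apply: heart_luxemburg_norm_fin; exact: L0_measurable.
have MD (a : R) (X Y Z : L0 Q) : MuQ Q phi0 X -> MuQ Q phi0 Y ->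
    (\forall w \ae Q, `|Z w| <= `|a| * `|X w| + `|Y w|) -> MuQ Q phi0 Z.
  move=> /MuQ_heart hX /MuQ_heart hY ZXY; apply/MuQ_heart.
  by apply: (heart_add (normr_ge0 a) _ _ _ ZXY hX hY); exact: L0_measurable.
split.
- split.
  + apply/MuQ_heart; apply: heart_ae_eq heart_cst0 => //.
    by apply: filterS (L0_0 Q) => w ->.
  + move=> a X Y MX MY; apply: (MD a X Y) => //; near=> w.
    rewrite (near (L0D _ _) w)// (near (L0Z _ _) w)// -normrM.
    exact: ler_normD.
  + move=> X Y MX MY; apply: (MD 1 X Y) => //; near=> w.
    rewrite (near (L0U _ _) w)// normr1 mul1r.
    by case: (leP (X w) (Y w)) => _; rewrite ?lerDl ?lerDr.
  + move=> X Y MX MY; apply: (MD 1 X Y) => //; near=> w.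
    rewrite (near (L0I _ _) w)// normr1 mul1r.
    by case: (leP (X w) (Y w)) => _; rewrite ?lerDl ?lerDr.
- split.
  + by move=> X MX; rewrite luxemburgQE luxemburg_norm_ge0 Mfin.
  + move=> X MX; rewrite luxemburgQE => /(luxemburg_norm_eq0 (L0_measurable X)) X0.
    by apply/L0_eqP; apply: filterS2 X0 (L0_0 Q) => w -> ->.
  + move=> a X MX; rewrite !luxemburgQE.
    rewrite -(luxemburg_norm_scale a (L0_measurable X) (Mfin _ MX)).
    apply/eqP; rewrite eq_le; apply/andP; split; apply: luxemburg_norm_mono;
      try exact: L0_measurable; try exact: (measurable_scale a (L0_measurable X));
      by apply: filterS (L0Z a X) => w ->.
  + move=> X Y MX MY; rewrite !luxemburgQE.
    apply: luxemburg_norm_triangle (Mfin _ MX) (Mfin _ MY);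
      try exact: L0_measurable.
    by apply: filterS (L0D X Y) => w ->; exact: ler_normD.
- move=> X Y MX MY /L0_leP XY; rewrite !luxemburgQE.
  apply: luxemburg_norm_mono; try exact: L0_measurable.
  by apply: filterS3 (L0absE X) (L0absE Y) XY => w -> ->.
move=> U MU cU.
have NB (X Y : L0 Q) (g : {mfun T >-> R}) : (\forall w \ae Q, Y w = g w) ->
    luxemburgQ Q phi0 (X - Y) = luxemburg_norm (fun w => X w - g w).
  move=> Yg; rewrite luxemburgQE.
  have mXg : measurable_fun [set: T] (fun w => X w - g w).
    by apply: measurable_funB => //; exact: L0_measurable.
  apply/eqP; rewrite eq_le; apply/andP; split; apply: luxemburg_norm_mono;
    try exact: L0_measurable; try exact: mXg; near=> w;
    by rewrite (near (L0D _ _) w)// (near (L0N _) w)// (near Yg w).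
have mU n := L0_measurable (U n).
have hU n : heart (U n) by exact/MuQ_heart.
have [|g [mg hg Ug]] := luxemburg_norm_complete mU hU.
  move=> e e0; have [n0 Hn0] := cU e e0; exists n0 => m n m0 n0'.
  by rewrite -(NB _ (U n) (L0rep (U n))); [exact: Hn0|exact: nearW].
pose G : {mfun T >-> R} := mfun_Sub (mem_set mg).
exists (L0cls Q G).
  apply/MuQ_heart; apply: heart_ae_eq hg => //.
  by apply: filterS (L0clsE Q G) => w ->.
apply: cvge0_squeeze => [n|e /Ug].
  by rewrite luxemburgQE luxemburg_norm_ge0.
by apply: filterS => n; rewrite (NB _ _ G)//; exact: L0clsE.
Unshelve. all: by end_near. Qed.

Lemma luxemburgQ_order_continuous :
  order_continuous_norm (MuQ Q phi0) (luxemburgQ Q phi0).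
Proof.
move=> U Y /MuQ_heart hY UY U0.
have mU n := L0_measurable (U n).
have UYn n : \forall w \ae Q, `|U n w| <= `|Y w|.
  have /L0_leP := UY n; apply: filterS2 (L0absE (U n)) => w -> /le_trans; apply.
  exact: ler_norm.
apply: cvge0_squeeze => [n|e e0]; first by rewrite luxemburgQE luxemburg_norm_ge0.
have eV0 : 0 < e^-1 by rewrite invr_gt0.
have hYe : heart (fun w => e^-1 * Y w).
  apply: (@heart_add e^-1 Y (fun=> 0)) => //; first exact: ltW.
  - exact: measurable_scale (L0_measurable Y).
  - by apply: nearW => w; rewrite normr0 addr0 normrM (gtr0_norm eV0).
  - exact: heart_cst0.
have := @heart_dominated_cvg0 (fun n w => e^-1 * U n w) _ 1 _
  (measurable_scale _ (L0_measurable Y)) hYe _ _ ltr01.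
move=> /(_ (fun n => measurable_scale _ (mU n)) _ _)/wrap[||].
- by move=> n; apply: filterS (UYn n) => w UYw; rewrite !normrM ler_wpM2l.
- apply: filterS U0 => w U0w; rewrite -(mulr0 e^-1); exact: cvgMl_tmp.
by apply: filterS => n Un; rewrite luxemburgQE; exact: luxemburg_norm_le.
Qed.

End modular.

Unset Implicit Arguments.

Theorem theorem4p9 (d : measure_display) (T : measurableType d) (R : realType)
  (P : probability T R) (phi0 : Linfty P -> R)
  (phi0_convex : monotone_convex phi0)
  (phi0_lebesgue : lebesgue_property phi0)
  (phi0_0 : phi0 0 = 0)
  (Zhat : L1 P) (Zhat_dominating : dominating phi0 Zhat)
  (Q : probability T R) (Q_density : normalized_density Q Zhat) :
  banach_lattice (MuQ Q phi0) (luxemburgQ Q phi0) /\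
  order_continuous_norm (MuQ Q phi0) (luxemburgQ Q phi0).
Proof.
split.
  exact: luxemburgQ_banach_lattice phi0_convex phi0_lebesgue phi0_0 _
    Zhat_dominating _ Q_density.
exact: luxemburgQ_order_continuous phi0_convex phi0_lebesgue phi0_0 _
  Zhat_dominating _ Q_density.
Qed.
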